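(* Let $\alpha\in(0,1)$. For each $N$ let $\psi$ be a function on $[0,T]\times\frac1N\mathbb T_N^n$ such that $\xi_e=\xi_e^N:=\nabla_e^N\psi$ ($|e|=1$, $e>0$) satisfies the system $$\partial_t\xi_e=-\nabla^N_e\Big\{\bar a\sum_{|e'|=1,e'>0}\nabla^{N,*}_{e'}\xi_{e'}\Big\}+\nabla^N_eg,$$ with $\bar a=\bar a(t,\frac xN)$, $g=g(t,\frac xN)$ ($g$ continuous in $t$). Assume, with constants independent of $N$: $c_-\le\bar a\le c_+$ with $0<c_-<c_+<\infty$; $$|\bar a(t_1,\tfrac{x_1}N)-\bar a(t_2,\tfrac{x_2}N)|\le\bar B\big\{|t_2-t_1|^{\frac\alpha2}+|\tfrac{x_2}N-\tfrac{x_1}N|^\alpha\big\}\quad\text{for all }t_1,t_2\in[0,T],\ x_1,x_2\in\mathbb T_N^n,\ \bar B<\infty;$$ $$\sup_N\|\bar a(0,\cdot)\|_{C_N^4}\le\mathcal C_1<\infty;\qquad\sup_{N,e}|\nabla^N_eg|_0\le G^1_\infty<\infty;\qquad\sup_{N,e}|\xi^N_e|_0\le W_\infty<\infty;$$ $$\sup_N\|\psi(0)\|_{C_N^4}\le\mathcal C_0<\infty\quad\text{(and so }\sup_N\|\xi^N_e(0)\|_{C_N^3}\le\mathcal C_0).$$ Then there are quantities $\mathcal C_6,\mathcal C_7$ depending only on $\bar B,\mathcal C_0,\mathcal C_1,\alpha$ and a constant $C=C(n,c_\pm,T,\alpha)$ (independent of $N$) such that $$|\tilde\xi^N_\cdot|_{1+\alpha}\le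 C\big[(\bar B+1)^{1+\frac1\alpha}(W_\infty+\mathcal C_6)+G^1_\infty+\mathcal C_7\big],$$ $$|\nabla^N\tilde\xi^N_\cdot|_0\le C\big[(\bar B+1)^{\frac1\alpha}(W_\infty+\mathcal C_6)+(\bar B+1)^{-1}(G^1_\infty+\mathcal C_7)\big],$$ $$[\nabla^N\tilde\xi^N_\cdot]_\alpha\le C\big[(\bar B+1)^{1+\frac1\alpha}(W_\infty+\mathcal C_6)+G^1_\infty+\mathcal C_7\big],$$ and, with a universal constant $C'$, $$\mathcal C_6\le C'(\bar B+1)^{\frac1\alpha}\mathcal C_0(1+\mathcal C_1^5),\qquad\mathcal C_7\le C'(\bar B+1)^{\frac2\alpha}\mathcal C_0(1+\mathcal C_1^{11}).$$
   Context: Lattice notation. $N\in\mathbb N$, $T>0$ fixed, $\mathbb T^n=\mathbb R^n/\mathbb Z^n$, $\mathbb T_N^n=(\mathbb Z/N\mathbb Z)^n$; functions on $\frac1N\mathbb T^n_N\subset\mathbb T^n$ are written $u(\frac xN)$. For $e\in\mathbb Z^n$, $|e|=1$: $\nabla_e^Nu(\frac xN)=N(u(\frac{x+e}N)-u(\frac xN))$, $\nabla_e^{N,*}=\nabla^N_{-e}$. ''$e>0$'' means that the nonzero component of $e$ is $1$. $\|u\|_{C^k_N}=\sum_{i=0}^k\sum_{e_1,\dots,e_i}\max_{x}|\nabla^N_{e_1}\cdots\nabla^N_{e_i}u(\frac xN)|$ (sum over unit vectors $|e_j|=1$). Norms. $\Omega=[0,T]\times\mathbb T^n$. For $X=(t,z)$,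 $Y=(s,y)\in\Omega$: $|X-Y|=\max\{|t-s|^{1/2},|z-y|\}$ with $|z-y|$ the Euclidean distance on the torus. For $F$ on $\Omega$, $\nabla^N_eF(t,z)=N(F(t,z+\frac eN)-F(t,z))$, and $|\nabla^NF(X)-\nabla^NF(Y)|=\max_{|e|=1,e>0}|\nabla^N_eF(X)-\nabla_e^NF(Y)|$. The polylinear interpolation in space of a function $u$ on $[0,T]\times\frac1N\mathbb T_N^n$ is $\tilde u(t,z)=\sum_{v\in\{0,1\}^n}\prod_{i=1}^n\vartheta(v_i,z_i)\,u(t,\frac{[Nz]+v}N)$, where $\vartheta(1,b)=\{Nb\}$, $\vartheta(0,b)=1-\{Nb\}$ and $[\cdot],\{\cdot\}$ are (componentwise) integer and fractional parts. $|F|_0$ is the supremum of $|F|$ over the domain of $F$. Unweighted seminorms: $[F]_\alpha=\sup_{X\neq Y\in\Omega}\frac{|F(X)-F(Y)|}{|X-Y|^\alpha}$, $[F]_{1+\alpha}=\sup_{X\neq Y\in\Omega}\frac{|\nabla^NF(X)-\nabla^NF(Y)|}{|X-Y|^\alpha}$, $\langle F\rangle_{1+\alpha}=\sup_{(t,z)\ne(s,z)\in\Omega}\frac{|F(t,z)-F(s,z)|}{|t-s|^{(1+\alpha)/2}}$, $|F|_{1+\alpha}=[F]_{1+\alpha}+\langle F\rangle_{1+\alpha}+|F|_0$. The dot subscript means maximum over unit vectors $e>0$: $|\tilde\xi^N_\cdot|_{1+\alpha}=\max_e|\tilde\xi_e^N|_{1+\alpha}$, $|\nabla^N\tilde\xi^N_\cdot|_0=\max_{e,e'}|\nabla^N_{e'}\tilde\xi^N_e|_0$,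 $[\nabla^N\tilde\xi^N_\cdot]_\alpha=\max_{e,e'}[\nabla^N_{e'}\tilde\xi^N_e]_\alpha$. *)

(* Defs.v *)
From mathcomp Require Import all_boot all_order all_algebra.
From mathcomp Require Import all_classical all_reals all_analysis.
Set Implicit Arguments.
Unset Strict Implicit.
Unset Printing Implicit Defensive.
Import Order.TTheory GRing.Theory Num.Theory numFieldNormedType.Exports.

Local Open Scope classical_set_scope.
Local Open Scope ring_scope.

(* (Z/NZ)^n for 0 < N. The index N.-1.+1 is equal to N and gives access to the
   addition modulo N also when N = 1 (whereas 'Z_1 is Z/2Z). A function u on
   (1/N)(Z/NZ)^n is represented by x |-> u(x/N). *)
Notation dtorus n N := 'rV['I_N.-1.+1]_n.

(* Reduction modulo N; [inZp 1] is the class of 1. *)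
Definition latt (n N : nat) (k : 'rV[int]_n) : dtorus n N :=
  \row_j ((inZp 1 : 'I_N.-1.+1) *~ k 0 j).

(* The 2n unit vectors: (b, i) stands for (-1)^b times the i-th basis vector,
   so that "e > 0" means b = false. *)
Definition dir (n : nat) : finType := (bool * 'I_n)%type.
Definition dpos (n : nat) (i : 'I_n) : dir n := (false, i).
Definition dopp (n : nat) (e : dir n) : dir n := (~~ e.1, e.2).
Definition dvec (n : nat) (e : dir n) : 'rV[int]_n :=
  (-1) ^+ e.1 *: delta_mx 0 e.2.

Definition dnabla (R : realType) (n N : nat) (e : dir n) (u : dtorus n N -> R)
    : dtorus n N -> R :=
  fun x => N%:R * (u (x + latt N (dvec e)) - u x).

Definition dnabla_adj (R : realType) (n N : nat) (e : dir n)
    (u : dtorus n N -> R) : dtorus n N -> R :=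
  dnabla (dopp e) u.

Definition CN_norm (R : realType) (n N k : nat) (u : dtorus n N -> R) : R :=
  \sum_(i < k.+1) \sum_(e : i.-tuple (dir n))
    \big[Num.max/0]_(x : dtorus n N) `|foldr (@dnabla R n N) u e x|.

(* Points of R^n/Z^n are represented by vectors of R^n, functions on R^n/Z^n by
   Z^n-periodic functions on R^n. *)
Definition torus_eq (R : realType) (n : nat) (z y : 'rV[R]_n) : Prop :=
  exists k : 'rV[int]_n, z - y = map_mx intr k.

Definition enorm (R : realType) (n : nat) (v : 'rV[R]_n) : R :=
  Num.sqrt (\sum_(i < n) v 0 i ^+ 2).

Definition torus_dist (R : realType) (n : nat) (z y : 'rV[R]_n) : R :=
  inf [set enorm (z - y + map_mx intr k) | k in [set: 'rV[int]_n]].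

Definition torus_pt (R : realType) (n N : nat) (x : dtorus n N) : 'rV[R]_n :=
  \row_j ((x 0 j : nat)%:R / N%:R).

(* [0, T] x A; it is Omega when A is 'rV[R]_n. *)
Definition cyl (R : realType) (T : R) (A : Type) : set (R * A) :=
  [set X | 0 <= X.1 <= T].

Definition par_dist (R : realType) (n : nat) (X Y : R * 'rV[R]_n) : R :=
  Num.max (Num.sqrt `|X.1 - Y.1|) (torus_dist X.2 Y.2).

Definition omega_neq (R : realType) (n : nat) (X Y : R * 'rV[R]_n) : Prop :=
  ~ (X.1 = Y.1 /\ torus_eq X.2 Y.2).

Definition nabla (R : realType) (n N : nat) (e : dir n)
    (F : R * 'rV[R]_n -> R) : R * 'rV[R]_n -> R :=
  fun X => N%:R * (F (X.1, X.2 + N%:R^-1 *: map_mx intr (dvec e)) - F X).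

(* All suprema below are taken in the extended reals, so that an upper bound on
   them by a real number contains their finiteness. *)
Definition sup_norm (R : realType) (A : Type) (D : set A) (F : A -> R)
    : \bar R :=
  ereal_sup [set (`|F a|)%:E | a in D].

Definition holder (R : realType) (n : nat) (T alpha : R)
    (F : R * 'rV[R]_n -> R) : \bar R :=
  ereal_sup [set r | exists X Y : R * 'rV[R]_n,
    [/\ cyl T X, cyl T Y, omega_neq X Y &
        r = (`|F X - F Y| / par_dist X Y `^ alpha)%:E]].

Definition holder1 (R : realType) (n N : nat) (T alpha : R)
    (F : R * 'rV[R]_n -> R) : \bar R :=
  ereal_sup [set r | exists X Y : R * 'rV[R]_n,
    [/\ cyl T X, cyl T Y, omega_neq X Y &
        r = ((\big[Num.max/0]_(i < n)
               `|nabla N (dpos i) F X - nabla N (dpos i) F Y|)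
             / par_dist X Y `^ alpha)%:E]].

Definition holder1_time (R : realType) (n : nat) (T alpha : R)
    (F : R * 'rV[R]_n -> R) : \bar R :=
  ereal_sup [set r | exists (t s : R) (z : 'rV[R]_n),
    [/\ 0 <= t <= T, 0 <= s <= T, t <> s &
        r = (`|F (t, z) - F (s, z)| / `|t - s| `^ ((1 + alpha) / 2))%:E]].

Definition holder1_norm (R : realType) (n N : nat) (T alpha : R)
    (F : R * 'rV[R]_n -> R) : \bar R :=
  (holder1 N T alpha F + holder1_time T alpha F
   + sup_norm (@cyl R T 'rV[R]_n) F)%E.

Definition theta (R : realType) (N : nat) (v : bool) (b : R) : R :=
  let frac := N%:R * b - (Num.floor (N%:R * b))%:~R in
  if v then frac else 1 - frac.

Definition interp (R : realType) (n N : nat) (u : R -> dtorus n N -> R)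
    : R * 'rV[R]_n -> R :=
  fun X => \sum_(v : {ffun 'I_n -> bool})
    (\prod_(i < n) theta N (v i) (X.2 0 i)) *
    u X.1 (latt N (\row_i (Num.floor (N%:R * X.2 0 i) + (v i)%:Z))).

Definition xi (R : realType) (n N : nat) (psi : R -> dtorus n N -> R)
    (i : 'I_n) : R -> dtorus n N -> R :=
  fun t => dnabla (dpos i) (psi t).

(* The time derivative is required at interior times only, together with
   continuity on [0, T]: since the right-hand side is continuous in t, this
   gives the one-sided derivatives at 0 and T as well. *)
Definition solves_system (R : realType) (n N : nat) (T : R)
    (abar g psi : R -> dtorus n N -> R) : Prop :=
  forall (i : 'I_n) (x : dtorus n N),
    {within `[0, T], continuous (fun t : R => xi psi i t x)} /\
    forall t : R, 0 < t < T ->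
      is_derive t 1 (fun s : R => xi psi i s x)
        (- dnabla (dpos i)
             (fun y => abar t y *
                \sum_(j < n) dnabla_adj (dpos j) (xi psi j t) y) x
         + dnabla (dpos i) (g t) x).

(* Main.v *)
Require Import Defs.
From mathcomp Require Import all_boot all_order all_algebra.
From mathcomp Require Import all_classical all_reals all_analysis.
From mathcomp Require Import ring lra zify.
Import Order.TTheory GRing.Theory Num.Theory numFieldNormedType.Exports.
Local Open Scope classical_set_scope.
Local Open Scope ring_scope.
Set Implicit Arguments.
Unset Strict Implicit.
Unset Printing Implicit Defensive.

(** Two obstacles shape the proof. The system governs only the lattice gradient of [psi], and
    nothing is assumed on how [psi] itself depends on time, so every quantity differentiated in time
    is built from differences of [psi]. And all bounds must be uniform in [N], so the finiteness of
    the lattice may be used qualitatively only. The increment over [rho] is split at the parabolic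
    time [t - s = rho^2]. Closer to [t], two differences of the heat flow cost
    [(t - s)^(alpha/2 - 1)], which is integrable at [s = t] because [alpha > 0]. Farther away this
    would leave a power of [t] instead of [rho]; a third difference, in the direction of the
    displacement, gains [rho / sqrt (t - s)], and [(t - s)^((alpha - 3)/2)] is integrable at
    infinity because [alpha < 1]. Both parts give [rho^alpha]. The term with [S] is the price of
    freezing at [x] while the Hessian is also evaluated at the displaced point. The analysis takes
    place on an abstract finite abelian group with a gauge [d]; of the torus it uses only that steps
    lengthen [d] by at most [1 / c], that [lap (d^2)] is bounded, and that moduli along straight
    walks add up. *)

(* The proof is Schauder theory in a form that survives discretization. Write
   [F = abar * lap psi + g], so that [d/dt (dq e psi) = dq e F] in every
   direction [e]. Freezing [abar] at the point [(t, x)] where the Hessian is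
   evaluated, [s |-> dq e' (dq e (P_(a0 (t - s)) (psi s)))] interpolates between
   the heat flow of the initial Hessian and the Hessian at time [t], and its
   derivative is the Hessian of [P_(a0 (t - s))] applied to
   [(abar - a0) * lap psi + g]. Bernstein's method gives the pointwise bound
   [t * (dq e (P_t f))^2 <= P_t (f^2)], and [P_t] applied to the squared distance
   grows linearly, so functions growing like [sigma^alpha + dist^alpha] are
   handled without any formula for the heat kernel. The increment of the Hessian
   over a distance [rho] is thus at most
   [C * rho^alpha * (B M + Ga + B rho^alpha S)], where [M] and [S] bound the
   Hessian and its spatial Hölder seminorm. Small [rho] absorbs [S], large [rho]
   is trivial, and interpolating [M] between [S] and the bound [W] on the
   gradient at the scale [r] with [r^alpha ~ 1 / (B + 1)] yields the powers of
   [B + 1]. Since the initial Hessian only enters through its Lipschitz constant,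
   [C6 = 0] and [C7 = C0] suffice. Time regularity follows by averaging over
   [~ N sqrt |t - s|] lattice steps. *)

(** * Comparison in time and exponential series *)

Section RealCalculus.
Variable R : realType.
Implicit Types (f g h : R -> R) (s t a b : R).

Lemma is_derive_add f g s a b : is_derive s 1 f a -> is_derive s 1 g b ->
  is_derive s 1 (fun t => f t + g t) (a + b).
Proof. by move=> df dg; exact: is_deriveD. Qed.

Lemma is_derive_sub f g s a b : is_derive s 1 f a -> is_derive s 1 g b ->
  is_derive s 1 (fun t => f t - g t) (a - b).
Proof. by move=> df dg; exact: is_deriveB. Qed.

Lemma is_derive_mul f g s a b : is_derive s 1 f a -> is_derive s 1 g b ->
  is_derive s 1 (fun t => f t * g t) (a * g s + f s * b).
Proof.
move=> df dg; apply: (is_derive_eq (is_deriveM df dg)).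
by rewrite /GRing.scale /= addrC mulrC.
Qed.

Lemma is_derive_scale (c : R) f s a : is_derive s 1 f a ->
  is_derive s 1 (fun t => c * f t) (c * a).
Proof. by move=> df; exact: is_deriveZ. Qed.

Lemma is_derive_fsum (I : Type) (r : seq I) (P : pred I) (h : I -> R -> R)
    (dh : I -> R) s :
  (forall i, is_derive s 1 (h i) (dh i)) ->
  is_derive s 1 (fun t => \sum_(i <- r | P i) h i t) (\sum_(i <- r | P i) dh i).
Proof.
move=> H; elim: r => [|i r IH].
  rewrite big_nil; under eq_fun do rewrite big_nil; exact: is_derive_cst.
rewrite big_cons; under eq_fun do rewrite big_cons.
by case: (P i) => //; exact: is_derive_add.
Qed.

Lemma is_derive_reflect f a t s df :
  is_derive (a * (t - s)) 1 f df ->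
  is_derive s 1 (fun r => f (a * (t - r))) (- a * df).
Proof.
move=> H.
have H0 : is_derive s 1 (fun r => a * (t - r)) (a * (0 - 1)).
  by apply: is_derive_scale; apply: is_derive_sub.
apply: (is_derive_eq (@is_derive1_comp _ f (fun r => a * (t - r)) _ _ _ H H0)).
by ring.
Qed.

Lemma is_derive_continuous f df : (forall s, is_derive s 1 f (df s)) ->
  continuous f.
Proof.
move=> H s; apply/differentiable_continuous; rewrite -derivable1_diffP.
by case: (H s).
Qed.

(* Comparison through the mean value theorem, which replaces integration in time. *)
Lemma ler_derive_increment f h df dh a b : a <= b ->
  {within `[a, b], continuous f} -> {within `[a, b], continuous h} ->
  (forall s, a < s < b -> is_derive s 1 f (df s)) ->
  (forall s, a < s < b -> is_derive s 1 h (dh s)) ->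
  (forall s, a < s < b -> df s <= dh s) ->
  f b - f a <= h b - h a.
Proof.
move=> ab cf ch Df Dh le_d.
move: ab; rewrite le_eqVlt => /orP[/eqP<-|ab]; first by rewrite !subrr.
have [||c cab] := @MVT R (fun s => f s - h s) (fun s => df s - dh s) a b ab.
- by move=> s; rewrite in_itv /= => sab; apply: is_derive_sub; [apply: Df|apply: Dh].
- by move=> x; apply: cvgB; [exact: cf|exact: ch].
move: cab; rewrite in_itv /= => /le_d dc E.
have : (df c - dh c) * (b - a) <= 0.
  by rewrite mulr_le0_ge0 // ?subr_le0 // subr_ge0 ltW.
by rewrite -E; lra.
Qed.

Lemma ler_norm_derive_increment f h df dh a b : a <= b ->
  {within `[a, b], continuous f} -> {within `[a, b], continuous h} ->
  (forall s, a < s < b -> is_derive s 1 f (df s)) ->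
  (forall s, a < s < b -> is_derive s 1 h (dh s)) ->
  (forall s, a < s < b -> `|df s| <= dh s) ->
  `|f b - f a| <= h b - h a.
Proof.
move=> ab cf ch Df Dh le_d; rewrite ler_norml; apply/andP; split.
  rewrite lerNl opprB.
  have := @ler_derive_increment (fun s => - f s) h (fun s => - df s) dh a b ab.
  rewrite opprK addrC; apply => //.
  - by move=> x; apply: cvgN; exact: cf.
  - by move=> s /Df H; exact: is_deriveN.
  - by move=> s /le_d; rewrite ler_norml => /andP[]; lra.
apply: (@ler_derive_increment f h df dh) => // s /le_d.
exact: (le_trans (ler_norm _)).
Qed.

Lemma within_continuous_fsum (I : Type) (r : seq I) (P : pred I)
    (h : I -> R -> R) (A : set R) :
  (forall i, {within A, continuous (h i)}) ->
  {within A, continuous (fun t => \sum_(i <- r | P i) h i t)}.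
Proof.
move=> H; elim: r => [|i r IH] x.
  by under eq_fun do rewrite big_nil; exact: cvg_cst.
under eq_fun do rewrite big_cons.
case: (P i); last exact: IH.
by apply: cvgD; [exact: H|exact: IH].
Qed.

Lemma within_continuous_mul f g (A : set R) :
  {within A, continuous f} -> {within A, continuous g} ->
  {within A, continuous (fun t => f t * g t)}.
Proof. by move=> cf cg x; apply: cvgM; [exact: cf|exact: cg]. Qed.

Lemma within_continuous_sub f g (A : set R) :
  {within A, continuous f} -> {within A, continuous g} ->
  {within A, continuous (fun t => f t - g t)}.
Proof. by move=> cf cg x; apply: cvgB; [exact: cf|exact: cg]. Qed.

Lemma within_continuous_scale (c : R) f (A : set R) :
  {within A, continuous f} -> {within A, continuous (fun t => c * f t)}.
Proof. by move=> cf; apply: within_continuous_mul => // x; exact: cvg_cst. Qed.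

End RealCalculus.

Section ExponentialSeries.
Variable R : realType.
Implicit Types (a : nat -> R).

Lemma cvg_fsum (I : Type) (r : seq I) (h : I -> nat -> R) (l : I -> R) :
  (forall i, h i @ \oo --> l i) ->
  (fun n => \sum_(i <- r) h i n) @ \oo --> \sum_(i <- r) l i.
Proof.
move=> H; elim: r => [|i r IH].
  by rewrite big_nil; under eq_fun do rewrite big_nil; exact: cvg_cst.
rewrite big_cons; under eq_fun do rewrite big_cons.
by apply: cvgD.
Qed.

Lemma is_cvg_pseries_fact a (M L K : R) : 0 <= L ->
  (forall k, `|a k| <= M * L ^+ k) -> cvgn (pseries (fun k => a k / k`!%:R) K).
Proof.
move=> L0 H; apply: normed_cvg.
have M0 : 0 <= M by have := H 0; rewrite expr0 mulr1; exact: le_trans.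
apply: (@series_le_cvg _ _ (fun k => M * exp_coeff (L * `|K|) k)) => [k|k|k|].
- exact: normr_ge0.
- by rewrite mulr_ge0 // /exp_coeff /= divr_ge0 // exprn_ge0 // mulr_ge0.
- rewrite /exp_coeff /= !normrM normrX normfV exprMn (normr_nat _ k`!).
  rewrite [X in _ <= X](_ : _ = M * L ^+ k / k`!%:R * `|K| ^+ k); last by ring.
  rewrite ler_wpM2r ?exprn_ge0 // ler_wpM2r ?invr_ge0 //.
- exact: is_cvg_seriesZ (is_cvg_series_exp_coeff _).
Qed.

Lemma is_derive_pseries_fact a (M L t : R) : 0 <= L ->
  (forall k, `|a k| <= M * L ^+ k) ->
  is_derive t 1 (fun s => limn (pseries (fun k => a k / k`!%:R) s))
    (limn (pseries (fun k => a k.+1 / k`!%:R) t)).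
Proof.
move=> L0 H.
have shift b : pseries_diffs (fun k => b k / k`!%:R) = (fun k => b k.+1 / k`!%:R) :> (nat -> R).
  apply/funext => k; rewrite /pseries_diffs factS natrM invfM mulrCA.
  by rewrite mulVKf // pnatr_eq0.
have H1 k : `|a k.+1| <= (M * L) * L ^+ k by rewrite -mulrA -exprS.
have H2 k : `|a k.+2| <= (M * L * L) * L ^+ k by rewrite -2!mulrA -2!exprS.
have := @pseries_snd_diffs _ (fun k => a k / k`!%:R) (`|t| + 1) t; rewrite -!shift.
move=> HH; apply: HH.
- exact: is_cvg_pseries_fact L0 H.
- by rewrite shift; exact: is_cvg_pseries_fact L0 H1.
- by rewrite !(shift a) shift; exact: is_cvg_pseries_fact L0 H2.
- by rewrite (@ger0_norm _ (_ + 1)) ?addr_ge0 // ltrDl.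
Qed.

End ExponentialSeries.

(** * The heat semigroup on a finite abelian group *)

Section HeatSemigroup.
Variables (R : realType) (V : finZmodType) (D : finType) (sh : D -> V).
Variables (op : D -> D) (c : R).
Hypothesis opK : involutive op.
Hypothesis sh_op : forall e, sh (op e) = - sh e.
Implicit Types (u f g : V -> R) (e : D) (x y z : V) (s t a : R).

Definition dq e u : V -> R := fun x => c * (u (x + sh e) - u x).
(** Since the sum contains [e] together with [op e], the first differences pair into symmetric
    second differences: this is the lattice Laplacian at mesh [1 / c]. *)
Definition lap u : V -> R := fun x => \sum_e c * dq e u x.

Definition jump u : V -> R := fun x => \sum_e c ^+ 2 * u (x + sh e).
Definition jump_rate : R := #|D|%:R * c ^+ 2.
Definition jump_iter k : V -> R := iter k jump (fun y => (y == 0)%:R).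

Arguments jump_iter : simpl never.

(* [lap = jump - jump_rate], and the series of [expR (t * jump)] has
   nonnegative terms. *)
Definition heat_kernel t y : R :=
  expR (- jump_rate * t) * limn (pseries (fun k => jump_iter k y / k`!%:R) t).

Lemma jump_rate_ge0 : 0 <= jump_rate.
Proof. by rewrite mulr_ge0 // sqr_ge0. Qed.

Lemma lapE u x : lap u x = jump u x - jump_rate * u x.
Proof.
rewrite /lap /dq /jump /jump_rate -mulrA mulr_natl -sumr_const -sumrB.
by apply: eq_bigr => e _; ring.
Qed.

Lemma jump_iter_bound k y : 0 <= jump_iter k y <= jump_rate ^+ k.
Proof.
elim: k y => [|k IH] y; first by rewrite expr0 /jump_iter /=; case: (_ == _); rewrite /= ?ler01 ?lexx.
have -> : jump_iter k.+1 y = \sum_e c ^+ 2 * jump_iter k (y + sh e) by [].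
apply/andP; split.
  apply: sumr_ge0 => e _; rewrite mulr_ge0 ?sqr_ge0 //.
  by case/andP: (IH (y + sh e)).
rewrite [leRHS]exprS {1}/jump_rate -mulrA mulr_natl -sumr_const.
apply: ler_sum => e _; rewrite ler_wpM2l ?sqr_ge0 //.
by case/andP: (IH (y + sh e)).
Qed.

Lemma jump_iter_norm k y : `|jump_iter k y| <= 1 * jump_rate ^+ k.
Proof. by have /andP[? ?] := jump_iter_bound k y; rewrite mul1r ger0_norm. Qed.

Lemma cvg_jump_series y t :
  cvgn (pseries (fun k => jump_iter k y / k`!%:R) t).
Proof. exact: is_cvg_pseries_fact jump_rate_ge0 (jump_iter_norm ^~ y). Qed.

Lemma heat_kernel0 y : heat_kernel 0 y = (y == 0)%:R.
Proof.
rewrite /heat_kernel mulr0 expR0 mul1r; apply: cvg_lim => //.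
(* The empty partial sum is skipped; from one term on, the series at time [0] is constant. *)
rewrite -cvg_shiftS /=.
rewrite [X in X @ _ --> _](_ : _ = (fun=> (y == 0)%:R)); first exact: cvg_cst.
apply/funext => n /=; rewrite /pseries /series /= big_nat_recl //= big1.
  by rewrite addr0 expr0 mulr1 fact0 divr1.
by move=> i _; rewrite expr0n mulr0.
Qed.

Lemma heat_kernel_ge0 t y : 0 <= t -> 0 <= heat_kernel t y.
Proof.
move=> t0; rewrite mulr_ge0 ?expR_ge0 //.
apply: limr_ge; first exact: cvg_jump_series.
apply: nearW => n; apply: sumr_ge0 => k _.
by rewrite mulr_ge0 ?exprn_ge0 // divr_ge0 //; case/andP: (jump_iter_bound k y).
Qed.

Lemma lim_jump_series y t :
  limn (pseries (fun k => jump_iter k.+1 y / k`!%:R) t) =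
  \sum_e c ^+ 2 * limn (pseries (fun k => jump_iter k (y + sh e) / k`!%:R) t).
Proof.
apply: cvg_lim => //.
have -> : pseries (fun k => jump_iter k.+1 y / k`!%:R) t =
    (fun n => \sum_e c ^+ 2 * pseries (fun k => jump_iter k (y + sh e) / k`!%:R) t n).
  apply/funext => n; rewrite /pseries /series /=.
  under [RHS]eq_bigr do rewrite mulr_sumr.
  rewrite exchange_big /=; apply: eq_bigr => k _.
  rewrite -[jump_iter k.+1 y]/(jump (jump_iter k) y) /jump !mulr_suml.
  by apply: eq_bigr => e _; rewrite !mulrA.
apply: cvg_fsum => e; apply: cvgM; first exact: cvg_cst.
exact: cvg_jump_series.
Qed.

Lemma is_derive_heat_kernel t y :
  is_derive t 1 (heat_kernel ^~ y) (lap (heat_kernel t) y).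
Proof.
have H1 := @is_derive_pseries_fact R (jump_iter ^~ y) 1 jump_rate t
  jump_rate_ge0 (jump_iter_norm ^~ y).
have H2 : is_derive t 1 (fun s => expR (- jump_rate * s))
    (expR (- jump_rate * t) * (- jump_rate * 1)).
  by apply: (@is_derive1_comp _ expR); apply: is_derive_scale.
apply: (is_derive_eq (is_derive_mul H2 H1)).
rewrite lim_jump_series lapE /jump mulr_sumr addrC; congr (_ + _).
  by apply: eq_bigr => e _; rewrite /heat_kernel mulrCA.
by rewrite /heat_kernel; ring.
Qed.

(** Written as an average over displacements, so that translations, and with them all [dq e],
    commute with it without any symmetry of the kernel. *)
Definition heat t f : V -> R := fun x => \sum_y heat_kernel t y * f (x + y).

Lemma heat0 f x : heat 0 f x = f x.
Proof.
rewrite /heat (bigD1 0) //= heat_kernel0 eqxx mul1r addr0 big1 ?addr0 // => y.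
by rewrite heat_kernel0 => /negbTE->; rewrite mul0r.
Qed.

Lemma heatD t f g x : heat t (fun y => f y + g y) x = heat t f x + heat t g x.
Proof. by rewrite -big_split; apply: eq_bigr => y _; rewrite mulrDr. Qed.

Lemma heatZ t a f x : heat t (fun y => a * f y) x = a * heat t f x.
Proof. by rewrite mulr_sumr; apply: eq_bigr => y _; rewrite mulrCA. Qed.

Lemma heat_shift t f z x : heat t (fun y => f (y + z)) x = heat t f (x + z).
Proof. by apply: eq_bigr => y _; rewrite addrAC. Qed.

Lemma heat_dq t f e x : heat t (dq e f) x = dq e (heat t f) x.
Proof.
rewrite /dq heatZ heatD heat_shift; congr (c * (_ + _)).
by rewrite -mulN1r -heatZ; apply: eq_bigr => y _; rewrite mulN1r.
Qed.

Lemma heat_le t f g x : 0 <= t -> (forall y, f y <= g y) ->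
  heat t f x <= heat t g x.
Proof.
by move=> t0 fg; apply: ler_sum => y _; rewrite ler_wpM2l ?heat_kernel_ge0.
Qed.

(** Summation by parts sends [e] to [op e]; this is where the directions must come in opposite
    pairs. *)
Lemma lap_adj f g : \sum_y lap f y * g y = \sum_y f y * lap g y.
Proof.
under eq_bigr do rewrite lapE mulrBl.
under [RHS]eq_bigr do rewrite lapE mulrBr.
rewrite !sumrB; congr (_ - _); last by apply: eq_bigr => y _; ring.
rewrite /jump; under eq_bigr do rewrite mulr_suml.
under [RHS]eq_bigr do rewrite mulr_sumr.
rewrite exchange_big [RHS]exchange_big [RHS](reindex_inj (inv_inj opK)) /=.
apply: eq_bigr => e _; rewrite [RHS](reindex_inj (addIr (sh e))) /=.
by apply: eq_bigr => y _; rewrite sh_op addrK; ring.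
Qed.

Lemma lap_shift f z x : lap (fun y => f (y + z)) x = lap f (x + z).
Proof. by apply: eq_bigr => e _; rewrite /dq addrAC. Qed.

(** Duhamel's formula in differential form: the time derivative of the kernel is [- a * lap] of it,
    which [lap_adj] moves onto [u]. *)
Lemma is_derive_duhamel (u du : R -> V -> R) a t s x :
  (forall y, is_derive s 1 (u ^~ y) (du s y)) ->
  is_derive s 1 (fun r => heat (a * (t - r)) (u r) x)
    (heat (a * (t - s)) (fun y => du s y - a * lap (u s) y) x).
Proof.
move=> Du.
have := @is_derive_fsum R V (index_enum V) xpredT
  (fun y r => heat_kernel (a * (t - r)) y * u r (x + y)) _ s
  (fun y => is_derive_mul (is_derive_reflect (is_derive_heat_kernel _ y)) (Du (x + y))).
move=> /is_derive_eq; apply.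
rewrite big_split /= /heat.
have -> : \sum_y - a * lap (heat_kernel (a * (t - s))) y * u s (x + y) =
   - a * \sum_y heat_kernel (a * (t - s)) y * lap (u s) (x + y).
  under eq_bigr do rewrite -mulrA.
  rewrite -mulr_sumr (lap_adj _ (fun y => u s (x + y))); congr (_ * _).
  apply: eq_bigr => y _; congr (_ * _).
  by rewrite [in RHS]addrC -lap_shift; apply: eq_bigr => e _; rewrite /dq !(addrC x).
by rewrite mulr_sumr -big_split; apply: eq_bigr => y _ /=; ring.
Qed.

Lemma is_derive_heat f t x : is_derive t 1 (fun s => heat s f x) (heat t (lap f) x).
Proof.
have := @is_derive_fsum R V (index_enum V) xpredT
  (fun y s => heat_kernel s y * f (x + y)) _ t
  (fun y => is_derive_mul (is_derive_heat_kernel t y) (is_derive_cst (f (x + y)) t 1)).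
move=> /is_derive_eq; apply.
under eq_bigr do rewrite mulr0 addr0.
rewrite (lap_adj _ (fun y => f (x + y))); apply: eq_bigr => y _; congr (_ * _).
by rewrite [in RHS]addrC -lap_shift; apply: eq_bigr => e _; rewrite /dq !(addrC x).
Qed.

Lemma lap_heat t f x : lap (heat t f) x = heat t (lap f) x.
Proof.
rewrite /lap /heat; under [RHS]eq_bigr do rewrite mulr_sumr.
rewrite exchange_big /=; apply: eq_bigr => e _.
rewrite -heat_dq /heat mulr_sumr; apply: eq_bigr => y _; ring.
Qed.

(* The maximum principle: [s |-> heat (a * (t - s)) (u s) x] is nonincreasing. *)
Lemma heat_comparison (u du : R -> V -> R) a t x : 0 <= a -> 0 <= t ->
  (forall s y, is_derive s 1 (u ^~ y) (du s y)) ->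
  (forall s y, 0 <= s <= t -> du s y <= a * lap (u s) y) ->
  u t x <= heat (a * t) (u 0) x.
Proof.
move=> a0 t0 Du le_du.
have D1 s := is_derive_duhamel a t x (Du s).
have : heat (a * (t - t)) (u t) x - heat (a * (t - 0)) (u 0) x <= 0 - 0.
  apply: (@ler_derive_increment R (fun s => heat (a * (t - s)) (u s) x)
    (cst 0) _ _ 0 t t0 _ _ (fun s _ => D1 s)
    (fun s _ => is_derive_cst (0 : R) s (1 : R))) => [||s /andP[s0 st]].
  - apply: continuous_subspaceT; exact: is_derive_continuous D1.
  - by move=> y; exact: cvg_cst.
  have -> : 0 = heat (a * (t - s)) (fun=> 0) x.
    by rewrite /heat big1 // => y _; rewrite mulr0.
  apply: heat_le => [|y]; first by rewrite mulr_ge0 // subr_ge0 ltW.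
  by rewrite subr_le0; apply: le_du; rewrite !ltW.
by rewrite subrr mulr0 heat0 !subr0 subr_le0.
Qed.

End HeatSemigroup.

Section HeatEstimates.
Variables (R : realType) (V : finZmodType) (D : finType) (sh : D -> V).
Variables (op : D -> D) (c : R).
Hypothesis opK : involutive op.
Hypothesis sh_op : forall e, sh (op e) = - sh e.
Implicit Types (u f g : V -> R) (e : D) (x y z : V) (s t a : R).

Local Notation dq := (dq sh c).
Local Notation lap := (lap sh c).
Local Notation heat := (heat sh c).

Lemma lap_dq e f x : lap (dq e f) x = dq e (lap f) x.
Proof.
rewrite /lap /dq -sumrB mulr_sumr; apply: eq_bigr => e' _.
by rewrite (addrAC x); ring.
Qed.

Lemma lapD f g x : lap (fun y => f y + g y) x = lap f x + lap g x.
Proof. by rewrite -big_split; apply: eq_bigr => e _ /=; rewrite /dq; ring. Qed.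

Lemma lapZ a f x : lap (fun y => a * f y) x = a * lap f x.
Proof. by rewrite /lap mulr_sumr; apply: eq_bigr => e _ /=; rewrite /dq; ring. Qed.

(** The carré du champ identity: the defect of the Leibniz rule for a square is the sum of all
    squared differences, the good term in Bernstein's method. *)
Lemma lap_sqr f x :
  lap (fun y => f y ^+ 2) x = 2 * f x * lap f x + \sum_e dq e f x ^+ 2.
Proof.
rewrite /lap mulr_sumr -big_split; apply: eq_bigr => e _ /=.
by rewrite /dq; ring.
Qed.

Lemma dq_sqr_le_lap e f x :
  dq e f x ^+ 2 + 2 * f x * lap f x <= lap (fun y => f y ^+ 2) x.
Proof.
rewrite lap_sqr (bigD1 e) //=.
have : 0 <= \sum_(i | i != e) dq i f x ^+ 2.
  by apply: sumr_ge0 => i _; exact: sqr_ge0.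
lra.
Qed.

Lemma heat_ext t f g x : f =1 g -> heat t f x = heat t g x.
Proof. by move=> fg; apply: eq_bigr => y _; rewrite fg. Qed.

Lemma heat_unique (u du : R -> V -> R) a t x : 0 <= a -> 0 <= t ->
  (forall s y, is_derive s 1 (u ^~ y) (du s y)) ->
  (forall s y, 0 <= s <= t -> du s y = a * lap (u s) y) ->
  u t x = heat (a * t) (u 0) x.
Proof.
move=> a0 t0 Du eq_du; apply/eqP; rewrite eq_le.
rewrite (heat_comparison opK sh_op x a0 t0 Du) => [/=|s y st]; last by rewrite eq_du.
have D1 s y : is_derive s 1 (fun s => -1 * u s y) (-1 * du s y) by exact: is_derive_scale.
have := heat_comparison opK sh_op (u := fun s y => -1 * u s y) (c := c) x a0 t0 D1.
rewrite heatZ !mulN1r lerN2; apply => s y st.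
by rewrite eq_du // (lapZ (-1) (u s)) mulrCA.
Qed.

(** Uniqueness replaces the multiplication of exponential series: [r |-> heat (r + s) f] solves the
    heat equation with initial value [heat s f]. *)
Lemma heatA s t f x : 0 <= s -> 0 <= t ->
  heat t (heat s f) x = heat (t + s) f x.
Proof.
move=> s0 t0; apply/esym.
have := @heat_unique (fun r => heat (r + s) f) (fun r => heat (r + s) (lap f)) 1 t x.
rewrite mul1r add0r; apply => // [r y|r y _]; last by rewrite mul1r lap_heat.
have Dr : is_derive r 1 (fun r => r + s) 1.
  by apply: (is_derive_eq (is_derive_add (is_derive_id r 1) (is_derive_cst s r 1))); rewrite addr0.
have Dh : is_derive (r + s) 1 (fun r => heat r f y) (heat (r + s) (lap f) y).
  exact: is_derive_heat.
by have := @is_derive1_comp _ _ (fun r => r + s) _ _ _ Dh Dr; rewrite mulr1.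
Qed.

Lemma heat_cst t a x : 0 <= t -> heat t (fun=> a) x = a.
Proof.
move=> t0; apply/esym.
have := @heat_unique (fun _ _ => a) (fun _ _ => 0) 1 t x.
rewrite mul1r; apply => // s y _.
by rewrite mul1r /lap big1 // => e _; rewrite /dq subrr !mulr0.
Qed.

(* Bernstein's method: [t |-> t * (dq e P_t f)^2 + (P_t f)^2] is a subsolution. *)
Lemma bernstein e t f x : 0 <= t ->
  t * dq e (heat t f) x ^+ 2 <= heat t (fun y => f y ^+ 2) x.
Proof.
move=> t0.
pose u s y := s * dq e (heat s f) y ^+ 2 + heat s f y ^+ 2.
have Dh s y : is_derive s 1 (fun s => heat s f y) (heat s (lap f) y).
  exact: is_derive_heat.
have Ddq s y : is_derive s 1 (fun s => dq e (heat s f) y) (dq e (heat s (lap f)) y).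
  by apply: is_derive_scale; apply: is_derive_sub.
have Du s y := is_derive_add
  (is_derive_mul (is_derive_id s 1) (is_derive_mul (Ddq s y) (Ddq s y)))
  (is_derive_mul (Dh s y) (Dh s y)).
apply: (@le_trans _ _ (u t x)); first by rewrite /u lerDl sqr_ge0.
have <- : heat t (u 0) x = heat t (fun y => f y ^+ 2) x.
  by apply: heat_ext => y; rewrite /u mul0r add0r heat0.
rewrite -[in leRHS](mul1r t).
apply: (heat_comparison opK sh_op (u := u) x ler01 t0 Du) => s y /andP[s0 _].
rewrite mul1r /u lapD lapZ.
(* Differentiating the weight [s] produces [dq e (heat s f) y ^+ 2], which the carré du champ of
   [heat s f] pays for; the remaining terms match because [dq] and [heat] commute with [lap]. *)
have := dq_sqr_le_lap e (dq e (heat s f)) y.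
have := dq_sqr_le_lap e (heat s f) y.
rewrite lap_dq.
have -> : lap (heat s f) = heat s (lap f) by apply/funext => z; exact: lap_heat.
set a1 := dq e (heat s f) y; set a2 := lap _ y; set a3 := lap _ y.
set a4 := dq e (heat s (lap f)) y; set a5 := dq e _ y => H1 H2.
have {}H2 : s * (2 * a1 * a4) <= s * a3 by rewrite ler_wpM2l //; have := sqr_ge0 a5; lra.
rewrite /= mul1r; lra.
Qed.

(** Each difference consumes one time slice of length [t]. The bound on the square is itself a heat
    flow, so the slices compose by the semigroup law. *)
Lemma bernstein_iter (es : seq D) t f x : 0 < t ->
  foldr dq (heat ((size es)%:R * t) f) es x ^+ 2
    <= t ^- (size es) * heat ((size es)%:R * t) (fun y => f y ^+ 2) x.
Proof.
move=> t0; elim: es x => [|e es IH] x.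
  by rewrite /= mul0r !heat0 expr0 invr1 mul1r.
have k0 : 0 <= (size es)%:R * t by rewrite mulr_ge0 // ltW.
have comm (es' : seq D) g y : foldr dq (heat t g) es' y = heat t (foldr dq g es') y.
  elim: es' y => //= e' es' IH' y; rewrite heat_dq.
  by rewrite /dq !IH'.
have E : heat ((size (e :: es))%:R * t) f = heat t (heat ((size es)%:R * t) f).
  apply/funext => y; rewrite heatA //; last exact: ltW.
  by rewrite /= -natr1 mulrDl mul1r addrC.
rewrite E /=.
have -> : foldr dq (heat t (heat ((size es)%:R * t) f)) es
    = heat t (foldr dq (heat ((size es)%:R * t) f) es) by apply/funext => y; exact: comm.
rewrite [t ^+ _]exprS invfM -mulrA ler_pdivlMl //=.
apply: (le_trans (bernstein _ _ _ (ltW t0))).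
apply: (@le_trans _ _ (heat t (fun y => t ^- size es *
    heat ((size es)%:R * t) (fun z => f z ^+ 2) y) x)).
  by apply: heat_le => [|y]; [exact: ltW|exact: IH].
rewrite heatZ; apply: ler_wpM2l; first by rewrite invr_ge0 exprn_ge0 // ltW.
by rewrite heatA // ?(ltW t0) // -natr1 mulrDl mul1r addrC lexx.
Qed.

Lemma heat_le_lap q K t x : 0 <= t -> (forall y, lap q y <= K) ->
  heat t q x <= q x + K * t.
Proof.
move=> t0 le_q.
have : heat t q x - heat 0 q x <= K * t - K * 0.
  have Dq s : is_derive s 1 (fun s => heat s q x) (heat s (lap q) x).
    exact: is_derive_heat.
  have DK s : is_derive s 1 (fun s => K * s) (K * 1) by exact: is_derive_scale.
  apply: (ler_derive_increment t0 _ _ (fun s _ => Dq s) (fun s _ => DK s))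
    => [||s /andP[s0 st]].
  - by apply: continuous_subspaceT; exact: is_derive_continuous Dq.
  - by apply: continuous_subspaceT; exact: is_derive_continuous DK.
  rewrite mulr1 -[leRHS](@heat_cst s K x (ltW s0)).
  by apply: heat_le => //; exact: ltW.
by rewrite heat0 mulr0; lra.
Qed.

End HeatEstimates.

(** * Weighted estimates *)

Section PowerInequalities.
Variable R : realType.
Implicit Types (a r s t : R).

Lemma powR_le_1D a r : 0 <= a -> 0 < r <= 1 -> a `^ r <= 1 + a.
Proof.
move=> a0 /andP[r0 r1]; have [a1|a1] := leP a 1.
  apply: (@le_trans _ _ (1 `^ r)); last by rewrite powR1 lerDl.
  by rewrite ge0_ler_powR // ?nnegrE // ltW.
apply: (@le_trans _ _ a); last by rewrite lerDr.
by rewrite ler1_powR // ltW.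
Qed.

Lemma powRD_le a s r : 0 <= a -> 0 <= s -> 0 < r <= 1 ->
  (a + s) `^ r <= 2 * (a `^ r + s `^ r).
Proof.
move=> a0 s0 /andP[r0 r1].
have two : 2 `^ r <= 2 :> R by rewrite ler1_powR // ler1n.
have H (x y : R) : 0 <= x -> x <= y -> (x + y) `^ r <= 2 * y `^ r.
  move=> x0 xy; have y0 := le_trans x0 xy.
  apply: (@le_trans _ _ ((2 * y) `^ r)).
    by rewrite ge0_ler_powR ?nnegrE ?addr_ge0 ?mulr_ge0 // ?(ltW r0) //; lra.
  by rewrite powRM // ler_wpM2r // powR_ge0.
have [sa|/ltW sa] := leP a s.
  apply: (le_trans (H _ _ a0 sa)); rewrite ler_wpM2l // lerDr; exact: powR_ge0.
rewrite addrC; apply: (le_trans (H _ _ s0 sa)).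
by rewrite ler_wpM2l // lerDl; exact: powR_ge0.
Qed.

(** Trades a fractional power of the distance for its square, the weight whose heat flow is
    controlled by [heat_le_lap]. *)
Lemma powR_sqr_le a s r : 0 <= a -> 0 < s -> 0 < r <= 1 ->
  (a `^ r) ^+ 2 <= (s `^ r) ^+ 2 * (1 + a ^+ 2 / s ^+ 2).
Proof.
move=> a0 s0 r01.
have q0 : 0 <= a / s by rewrite divr_ge0 // ltW.
have -> : a `^ r = s `^ r * (a / s) `^ r.
  by rewrite -powRM ?(ltW s0) // mulrC divfK // gt_eqF.
rewrite exprMn ler_wpM2l ?sqr_ge0 // -expr_div_n !expr2 -powRM //.
by rewrite powR_le_1D // mulr_ge0.
Qed.

Lemma is_derive_powR_reflect t s r : s < t ->
  is_derive s 1 (fun x : R => (t - x) `^ r) (- r * (t - s) `^ (r - 1)).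
Proof.
move=> st.
have ts0 : 0 < t - s by rewrite subr_gt0.
have ts : t - s \in `]0, +oo[%R by rewrite in_itv /= andbT.
have Dp : is_derive (t - s) 1 (fun x : R => x `^ r) (r * (t - s) `^ (r - 1)).
  constructor; first exact: derivable_powR.
  by rewrite -derive1E powR_derive1.
have Dt : is_derive s 1 (fun x => t - x) (0 - 1) by exact: is_derive_sub.
have := @is_derive1_comp _ (fun x : R => x `^ r) (fun x => t - x) _ _ _ Dp Dt.
by rewrite sub0r mulrN1 mulNr.
Qed.

(** Continuity up to [t], where the derivative blows up if [r < 1]: the mean value theorem can then
    integrate the singularity. *)
Lemma within_continuous_powR_reflect a t r : a <= t -> 0 < r ->
  {within `[a, t], continuous (fun x : R => (t - x) `^ r)}.
Proof.
rewrite le_eqVlt => /orP[/eqP<-|at_] r0.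
  rewrite set_itv1; exact: continuous_subspace1.
have cont s : s < t -> {for s, continuous (fun x : R => (t - x) `^ r)}.
  move=> st; apply/differentiable_continuous; rewrite -derivable1_diffP.
  by case: (is_derive_powR_reflect r st).
apply/(continuous_within_itvP _ at_); split.
- by move=> s; rewrite in_itv /= => /andP[_ st]; exact: cont.
- by apply: cvg_at_right_filter; exact: cont.
apply/cvgrPdist_lt => e e0.
rewrite subrr powR0 ?gt_eqF //.
have e1 : 0 < e `^ r^-1 by exact: powR_gt0.
near=> s.
have st : 0 < t - s by rewrite subr_gt0; near: s; exact: nbhs_left_lt.
rewrite sub0r normrN ger0_norm ?powR_ge0 //.
have -> : e = (e `^ r^-1) `^ r by rewrite -powRrM mulVf ?gt_eqF // powRr1 // ltW.
rewrite gt0_ltr_powR // ?nnegrE ?ltW //.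
rewrite ltrBlDr -ltrBlDl; near: s; apply: nbhs_left_gt.
by rewrite ltrBlDr ltrDl.
Unshelve. all: by end_near. Qed.

End PowerInequalities.

Section WeightedEstimate.
Variables (R : realType) (V : finZmodType) (D : finType) (sh : D -> V).
Variables (op : D -> D) (c : R) (d : V -> R) (kappa alpha cm cp : R).
Hypothesis opK : involutive op.
Hypothesis sh_op : forall e, sh (op e) = - sh e.
Hypothesis d0 : d 0 = 0.
Hypothesis d_ge0 : forall y, 0 <= d y.
Hypothesis lap_d : forall y, lap sh c (fun z => d z ^+ 2) y <= kappa.
Hypothesis alpha01 : 0 < alpha <= 1.
Hypothesis cm_gt0 : 0 < cm.

Local Notation dq := (dq sh c).
Local Notation heat := (heat sh c).

(** Square root of what [bernstein_iter] yields for [m] slices of length [a * sigma^2 / m]. The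
    outer [2] comes from [(u + v)^2 <= 2 * (u^2 + v^2)], and [2 + kappa * cp] is [1 + 1] plus the
    mean of [d^2 / sigma^2] under the heat flow. *)
Definition weighted_cst (m : nat) : R :=
  Num.sqrt ((m%:R / cm) ^+ m * (2 * (2 + kappa * cp))).

Lemma weighted_estimate (es : seq D) (a sigma K : R) (f : V -> R) x :
  0 <= kappa -> (0 < size es)%N -> 0 < sigma -> cm <= a <= cp ->
  0 <= K -> (forall y, `|f (x + y)| <= K * (sigma `^ alpha + d y `^ alpha)) ->
  `|foldr dq (heat (a * sigma ^+ 2) f) es x|
    <= K * weighted_cst (size es) * (sigma `^ alpha / sigma ^+ size es).
Proof.
move=> k0 m0 s0 /andP[cma acp] K0 Hf; set m := size es.
have a0 : 0 < a := lt_le_trans cm_gt0 cma.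
have cp0 : 0 <= cp := le_trans (ltW a0) acp.
have mR : 0 < m%:R :> R by rewrite ltr0n.
have t0 : 0 < a * sigma ^+ 2 / m%:R by rewrite divr_gt0 // mulr_gt0 // exprn_gt0.
have := bernstein_iter c opK sh_op es f x t0.
rewrite -/m [m%:R * _]mulrC divfK ?gt_eqF // => H.
have sq : heat (a * sigma ^+ 2) (fun y => f y ^+ 2) x <=
    2 * K ^+ 2 * (sigma `^ alpha) ^+ 2 * (2 + kappa * cp).
  have le1 y : f (x + y) ^+ 2 <=
      (2 * K ^+ 2 * (sigma `^ alpha) ^+ 2) * (2 + sigma ^- 2 * d y ^+ 2).
    rewrite -real_normK ?num_real //.
    apply: (@le_trans _ _ ((K * (sigma `^ alpha + d y `^ alpha)) ^+ 2)).
      by rewrite lerXn2r // ?nnegrE // mulr_ge0 // addr_ge0 // powR_ge0.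
    have := powR_sqr_le (d_ge0 y) s0 alpha01.
    rewrite exprMn [_ / _]mulrC.
    set u := sigma `^ alpha; set v := d y `^ alpha; set w := sigma ^- 2 * _ => Hv.
    rewrite [leRHS](_ : _ = K ^+ 2 * (2 * u ^+ 2 * (2 + w))); last by ring.
    rewrite ler_wpM2l ?sqr_ge0 //; have := sqr_ge0 (u - v); nra.
  (* The weight depends on the displacement only, so its average is the heat flow of [d ^+ 2] read
     at the origin, where [d] vanishes. *)
  apply: (@le_trans _ _ (heat (a * sigma ^+ 2) (fun y =>
     (2 * K ^+ 2 * (sigma `^ alpha) ^+ 2) * (2 + sigma ^- 2 * d y ^+ 2)) 0)).
    rewrite /heat; apply: ler_sum => y _; rewrite add0r ler_wpM2l //.
    by apply: heat_kernel_ge0; rewrite mulr_ge0 ?sqr_ge0 // ltW.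
  have ht : 0 <= a * sigma ^+ 2 by rewrite mulr_ge0 ?sqr_ge0 // ltW.
  rewrite heatZ heatD heatZ (heat_cst c opK sh_op) //.
  apply: ler_wpM2l; first by rewrite mulr_ge0 ?sqr_ge0 // mulr_ge0 ?sqr_ge0.
  rewrite lerD2l.
  have := heat_le_lap opK sh_op 0 ht lap_d; rewrite d0 expr0n add0r => Hd.
  rewrite mulrC ler_pdivrMr ?exprn_gt0 //; apply: (le_trans Hd).
  by rewrite -mulrA ler_wpM2l // ler_wpM2r ?sqr_ge0.
have wc0 : 0 <= weighted_cst m by exact: sqrtr_ge0.
rewrite -ler_sqr ?nnegrE ?mulr_ge0 ?invr_ge0 ?powR_ge0 ?exprn_ge0 ?(ltW s0) //.
rewrite real_normK ?num_real //; apply: (le_trans H).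
apply: (@le_trans _ _ ((a * sigma ^+ 2 / m%:R) ^- m *
   (2 * K ^+ 2 * (sigma `^ alpha) ^+ 2 * (2 + kappa * cp)))).
  by rewrite ler_wpM2l // invr_ge0 exprn_ge0 // ltW.
have kc0 : 0 <= 2 * (2 + kappa * cp) by rewrite mulr_ge0 // addr_ge0 // mulr_ge0.
have -> : (a * sigma ^+ 2 / m%:R) ^- m = m%:R ^+ m / sigma ^+ m ^+ 2 / a ^+ m.
  rewrite expr_div_n invf_div exprMn invfM -!exprM (mulnC m 2).
  by rewrite mulrA mulrAC.
have -> : (K * weighted_cst m * (sigma `^ alpha / sigma ^+ m)) ^+ 2 =
   K ^+ 2 * (m%:R ^+ m / cm ^+ m * (2 * (2 + kappa * cp))) *
     ((sigma `^ alpha) ^+ 2 / sigma ^+ m ^+ 2).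
  rewrite [in LHS]exprMn [in LHS]exprMn expr_div_n sqr_sqrtr ?expr_div_n //.
  by rewrite mulr_ge0 // divr_ge0 // exprn_ge0 // ltW.
set s2 := (sigma ^+ m ^+ 2)^-1.
rewrite [X in X <= _](_ : _ = (K ^+ 2 * (sigma `^ alpha) ^+ 2 * s2
   * (2 * (2 + kappa * cp)) * m%:R ^+ m) / a ^+ m); last by ring.
rewrite [X in _ <= X](_ : _ = (K ^+ 2 * (sigma `^ alpha) ^+ 2 * s2
   * (2 * (2 + kappa * cp)) * m%:R ^+ m) / cm ^+ m); last by ring.
apply: ler_wpM2l.
  apply: mulr_ge0; last exact: exprn_ge0.
  apply: mulr_ge0 => //; rewrite /s2 mulr_ge0 ?invr_ge0 ?sqr_ge0 //.
  by rewrite mulr_ge0 ?sqr_ge0.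
rewrite lef_pV2 ?posrE ?exprn_gt0 //.
by rewrite lerXn2r // nnegrE ltW.
Qed.

End WeightedEstimate.

(** * Schauder estimates by freezing coefficients *)

Section SqrtPower.
Variable R : realType.

Lemma powR_sqrt_div (t r : R) (m : nat) : 0 < t ->
  Num.sqrt t `^ r / Num.sqrt t ^+ m = t `^ (r / 2 - m%:R / 2).
Proof.
move=> t0; rewrite -powR12_sqrt ?ltW // -powR_mulrn ?powR_ge0 //.
rewrite -!powRrM -powRB; last by rewrite (gt_eqF t0) implybT.
by congr (_ `^ _); ring.
Qed.

Lemma powR_sqrt_mul (t r : R) : 0 < t ->
  t `^ ((1 + r) / 2) = Num.sqrt t * Num.sqrt t `^ r.
Proof.
move=> t0; have s0 : 0 < Num.sqrt t by rewrite sqrtr_gt0.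
have -> : Num.sqrt t * Num.sqrt t `^ r = Num.sqrt t `^ (1 + r).
  by rewrite powRD ?(gt_eqF s0) ?implybT // powRr1 // ltW.
by rewrite -powR12_sqrt ?(ltW t0) // -powRrM [_ * (1 + r)]mulrC.
Qed.

End SqrtPower.

Section FreezingCoefficients.
Variables (R : realType) (V : finZmodType) (D : finType) (sh : D -> V).
Variables (op : D -> D) (c : R) (d : V -> R) (kappa alpha cm cp nn : R).
Hypothesis opK : involutive op.
Hypothesis sh_op : forall e, sh (op e) = - sh e.
Hypothesis c_gt0 : 0 < c.
Hypothesis d0 : d 0 = 0.
Hypothesis d_ge0 : forall y, 0 <= d y.
Hypothesis kappa_ge0 : 0 <= kappa.
Hypothesis lap_d : forall y, lap sh c (fun z => d z ^+ 2) y <= kappa.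
Hypothesis d_step : forall y e, d (y + sh e) <= d y + c^-1.
Hypothesis nn_ge0 : 0 <= nn.
Hypothesis alpha01 : 0 < alpha < 1.
(** On the torus [nn] is the dimension: a displacement is a sum of one straight walk per
    coordinate. *)
Hypothesis d_holder : forall (u : V -> R) (S : R), 0 <= S ->
  (forall e k x, `|u (x + sh e *+ k) - u x| <= S * (k%:R / c) `^ alpha) ->
  forall x y, `|u (x + y) - u x| <= nn * S * d y `^ alpha.
Hypothesis cm_gt0 : 0 < cm.

Local Notation dq := (dq sh c).
Local Notation lap := (lap sh c).
Local Notation heat := (heat sh c).
Local Notation nD := (#|D|%:R : R).

Lemma d_steps y e k : d (y + sh e *+ k) <= d y + k%:R / c.
Proof.
elim: k => [|k IH]; first by rewrite mulr0n mul0r !addr0.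
rewrite mulrSr addrA; apply: (le_trans (d_step _ _)).
by rewrite -natr1 mulrDl mul1r addrA lerD2r.
Qed.

(** Both [e] and [op e] produce the same centred second difference, hence the factor [2^-1]. In this
    form, bounds on the Hessian control [lap]. *)
Lemma lap_second_difference u x :
  lap u x = 2^-1 * \sum_e dq e (dq e u) (x - sh e).
Proof.
have E e : dq e (dq e u) (x - sh e) = c * dq e u x + c * dq (op e) u x.
  by rewrite /dq sh_op subrK; ring.
under eq_bigr do rewrite E.
rewrite big_split /= [X in _ + X](_ : _ = lap u x).
  by rewrite -/(lap u x); field.
by rewrite /lap [RHS](reindex_inj (inv_inj opK)).
Qed.

Lemma lap_bound u x M : (forall e y, `|dq e (dq e u) y| <= M) ->
  `|lap u x| <= nD * M.
Proof.
move=> H; rewrite lap_second_difference normrM ger0_norm ?invr_ge0 //.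
apply: (@le_trans _ _ (2^-1 * \sum_(e : D) M)).
  rewrite ler_wpM2l ?invr_ge0 //; apply: (le_trans (ler_norm_sum _ _ _)).
  by apply: ler_sum => e _.
rewrite sumr_const -mulr_natl.
have : 0 <= nD * M.
  rewrite mulr_natl -sumr_const; apply: sumr_ge0 => e _; exact: le_trans (H e x).
lra.
Qed.

Lemma lap_increment u x z S :
  (forall e y, `|dq e (dq e u) (y + z) - dq e (dq e u) y| <= S) ->
  `|lap u (x + z) - lap u x| <= nD * S.
Proof.
move=> H; rewrite !lap_second_difference -mulrBr -sumrB normrM ger0_norm ?invr_ge0 //.
apply: (@le_trans _ _ (2^-1 * \sum_(e : D) S)).
  rewrite ler_wpM2l ?invr_ge0 //; apply: (le_trans (ler_norm_sum _ _ _)).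
  by apply: ler_sum => e _; rewrite [x + z - _]addrAC.
rewrite sumr_const -mulr_natl.
have : 0 <= nD * S.
  rewrite mulr_natl -sumr_const; apply: sumr_ge0 => e _; exact: le_trans (H e x).
lra.
Qed.

(** Differences do not see constants, so a source may be recentred at any value before its growth is
    measured. *)
Lemma foldr_dq_heat_subcst t f b (es : seq D) x : (0 < size es)%N ->
  foldr dq (heat t (fun y => f y - b)) es x = foldr dq (heat t f) es x.
Proof.
elim: es x => // e es IH x _ /=.
case: es IH => [_ /=|e' es IH].
  have H y : heat t (fun z => f z - b) y = heat t f y - b * heat t (fun=> 1) 0.
    rewrite /heat mulr_sumr -sumrB.
    by apply: eq_bigr => z _; ring.
  by rewrite /dq !H; ring.
by rewrite {1}/dq !IH.
Qed.

Lemma heat_norm_le t f b x : 0 <= t -> (forall y, `|f y| <= b) ->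
  `|heat t f x| <= b.
Proof.
move=> t0 H; rewrite -[leRHS](heat_cst c opK sh_op b x t0).
apply: (le_trans (ler_norm_sum _ _ _)); apply: ler_sum => y _.
by rewrite normrM ger0_norm ?heat_kernel_ge0 // ler_wpM2l ?heat_kernel_ge0.
Qed.

(** The increment over [k] steps is a sum of one-step quotients. The reference value [A] is free:
    [0] gives telescoping, a value of the Hessian gives interpolation and time regularity. *)
Lemma dq_average u l k x A b :
  (forall j, (j < k)%N -> `|dq l u (x + sh l *+ j) - A| <= b) ->
  `|u (x + sh l *+ k) - u x - k%:R / c * A| <= k%:R / c * b.
Proof.
elim: k => [_|k IH H]; first by rewrite mulr0n addr0 subrr !mul0r subr0 normr0.
have -> : u (x + sh l *+ k.+1) - u x - k.+1%:R / c * A =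
    (u (x + sh l *+ k) - u x - k%:R / c * A) + (dq l u (x + sh l *+ k) - A) / c.
  by rewrite mulrSr addrA -natr1 /dq; field; rewrite gt_eqF.
apply: (le_trans (ler_normD _ _)).
rewrite -natr1 [leRHS](_ : _ = k%:R / c * b + b / c); last by ring.
apply: lerD; first by apply: IH => j jk; apply: H; rewrite ltnS ltnW.
rewrite normrM normfV (ger0_norm (ltW c_gt0)) ler_wpM2r ?invr_ge0 ?(ltW c_gt0) //.
exact: H.
Qed.

Lemma dq_telescope u l k x b :
  (forall j, (j < k)%N -> `|dq l u (x + sh l *+ j)| <= b) ->
  `|u (x + sh l *+ k) - u x| <= k%:R / c * b.
Proof.
move=> H; have := @dq_average u l k x 0 b; rewrite mulr0 subr0; apply => j jk.
by rewrite subr0; exact: H.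
Qed.

Variables (T B Ga : R) (psi a g : R -> V -> R).
Hypothesis B_ge0 : 0 <= B.
Hypothesis Ga_ge0 : 0 <= Ga.
Hypothesis continuous_dq_psi : forall e x,
  {within `[0, T], continuous (fun t => dq e (psi t) x)}.
Hypothesis is_derive_dq_psi : forall e x t, 0 < t < T ->
  is_derive t 1 (fun s => dq e (psi s) x)
    (dq e (fun y => a t y * lap (psi t) y + g t y) x).
Hypothesis a_bound : forall t x, 0 <= t <= T -> cm <= a t x <= cp.
Hypothesis a_holder : forall t s x y, 0 <= t <= T -> 0 <= s <= T ->
  `|a s (x + y) - a t x| <= B * (`|t - s| `^ (alpha / 2) + d y `^ alpha).
Hypothesis g_holder : forall t x y, 0 <= t <= T ->
  `|g t (x + y) - g t x| <= Ga * d y `^ alpha.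

Definition hess e e' t x : R := dq e' (dq e (psi t)) x.

(** The first factor counts the uses of the bounds on [lap], the weighted constants are those for
    two and three differences, and the last factor dominates, up to [2], the integrals [4 / alpha]
    and [8 / (1 - alpha)] of the near and far singularities. *)
Definition freezing_cst : R :=
  (1 + nD + 2 * nn * nD) *
  (weighted_cst kappa cm cp 2 + weighted_cst kappa cm cp 3) *
  (4 / alpha + 4 / (1 - alpha)).

(** * Increment of the Hessian over one displacement *)

Section Increment.
Variables (e e' l : D) (k : nat) (x : V) (t M S I : R).
Hypothesis k_gt0 : (0 < k)%N.
Hypothesis t_bound : 0 < t <= T.
Hypothesis M_bound : forall e e' s y, 0 <= s <= T -> `|hess e e' s y| <= M.
Hypothesis S_ge0 : 0 <= S.
Hypothesis S_bound : forall e e' s l k y, 0 <= s <= T ->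
  `|hess e e' s (y + sh l *+ k) - hess e e' s y| <= S * (k%:R / c) `^ alpha.
Hypothesis I_bound : forall y,
  `|hess e e' 0 (y + sh l *+ k) - hess e e' 0 y| <= I * (k%:R / c) `^ alpha.

Let rho : R := k%:R / c.
Let a0 : R := a t x.
Let z : V := sh l *+ k.
Let Phi s y := a s y * lap (psi s) y + g s y - a0 * lap (psi s) y.
Let Z s y := foldr dq (heat (a0 * (t - s)) (Phi s)) [:: e'; e] y.
Let Q : R := 1 + nD + 2 * nn * nD.
Let K : R := Q * (B * M + Ga + B * rho `^ alpha * S).
Let C : R := weighted_cst kappa cm cp 2 + weighted_cst kappa cm cp 3.

Let rho_gt0 : 0 < rho.
Proof. by rewrite divr_gt0 // ltr0n. Qed.

Let t0 : 0 < t. Proof. by case/andP: t_bound. Qed.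
Let tT : t <= T. Proof. by case/andP: t_bound. Qed.
Let tcyl : 0 <= t <= T. Proof. by rewrite ltW. Qed.

Let a0_bound : cm <= a0 <= cp. Proof. exact: a_bound. Qed.
Let a0_ge0 : 0 <= a0.
Proof. by case/andP: a0_bound => h _; exact: le_trans (ltW cm_gt0) h. Qed.

Let M_ge0 : 0 <= M.
Proof. by apply: le_trans (M_bound e e' x tcyl). Qed.

Let w_bound s y : 0 <= s <= T -> `|lap (psi s) y| <= nD * M.
Proof. by move=> sT; apply: lap_bound => e1 y1; exact: M_bound. Qed.

Let w_holder s y v : 0 <= s <= T ->
  `|lap (psi s) (y + v) - lap (psi s) y| <= nn * (nD * S) * d v `^ alpha.
Proof.
move=> sT; apply: d_holder => [|e1 k1 y1]; first by rewrite mulr_ge0.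
by rewrite -mulrA; apply: lap_increment => e2 y2; exact: S_bound.
Qed.

Let nD_ge0 : 0 <= nD. Proof. exact: ler0n. Qed.
Let rhoa_ge0 : 0 <= rho `^ alpha. Proof. exact: powR_ge0. Qed.

Let K1_le : B * (nD * M) + Ga <= K.
Proof.
rewrite /K /Q.
have := mulr_ge0 B_ge0 M_ge0; have := mulr_ge0 (mulr_ge0 B_ge0 rhoa_ge0) S_ge0.
have := mulr_ge0 nn_ge0 nD_ge0.
move: nD_ge0 Ga_ge0; nra.
Qed.

Let K2_le : B * (nD * M) + Ga + 2 * B * rho `^ alpha * (nn * (nD * S)) <= K.
Proof.
rewrite /K /Q.
have := mulr_ge0 B_ge0 M_ge0; have := mulr_ge0 (mulr_ge0 B_ge0 rhoa_ge0) S_ge0.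
have := mulr_ge0 nn_ge0 nD_ge0.
move: nD_ge0 Ga_ge0; nra.
Qed.

Let K_ge0 : 0 <= K.
Proof.
by apply: le_trans K1_le; rewrite addr_ge0 // mulr_ge0 // mulr_ge0.
Qed.

Let powR_sqrt_half s : 0 <= s -> Num.sqrt s `^ alpha = s `^ (alpha / 2).
Proof. by move=> s0; rewrite -powR12_sqrt // -powRrM mulrC. Qed.

Let Phi_center s y : 0 <= s <= t ->
  `|Phi s (x + y) - g s x| <=
    (B * (nD * M) + Ga) * (Num.sqrt (t - s) `^ alpha + d y `^ alpha).
Proof.
move=> /andP[s0 st]; have sT : 0 <= s <= T by rewrite s0 (le_trans st).
rewrite powR_sqrt_half ?subr_ge0 //.
have := a_holder x y tcyl sT; rewrite (@ger0_norm _ (t - s)) ?subr_ge0 // => Ha.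
have Hg := g_holder x y sT.
have -> : Phi s (x + y) - g s x =
  (a s (x + y) - a0) * lap (psi s) (x + y) + (g s (x + y) - g s x).
  by rewrite /Phi; ring.
apply: (le_trans (ler_normD _ _)); rewrite [leRHS]mulrDl lerD //.
  rewrite normrM [leRHS]mulrAC; apply: ler_pM => //; exact: w_bound.
by apply: (le_trans Hg); rewrite ler_wpM2l // lerDr powR_ge0.
Qed.

(** Around [x + z], [a - a0] no longer vanishes but is at most [2 * B * rho^alpha]. Its product with
    [lap (psi s)] is recentred at [x + z], which costs the seminorm [S] with this small factor; the
    restriction on [s] keeps the time part of [a - a0] below the same scale. *)
Let Phi_near s y : 0 <= s <= t -> Num.sqrt (t - s) <= rho ->
  `|Phi s (x + z + y) - ((a s (x + z) - a0) * lap (psi s) (x + z) + g s (x + z))|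
    <= K * (Num.sqrt (t - s) `^ alpha + d y `^ alpha).
Proof.
move=> /andP[s0 st] srho; have sT : 0 <= s <= T by rewrite s0 (le_trans st).
have a01 : 0 < alpha by case/andP: alpha01.
have := a_holder x z tcyl sT; rewrite (@ger0_norm _ (t - s)) ?subr_ge0 // -powR_sqrt_half ?subr_ge0 // => Ha1.
have Ha2 : `|a s (x + z + y) - a s (x + z)| <= B * d y `^ alpha.
  by have := a_holder (x + z) y sT sT; rewrite subrr normr0 powR0 ?add0r // gt_eqF // divr_gt0.
have Hg := g_holder (x + z) y sT.
have Hw := w_holder (x + z) y sT.
have Hwb := w_bound (x + z + y) sT.
have dz : d z <= rho by have := d_steps 0 l k; rewrite d0 !add0r.
have Ha3 : `|a s (x + z) - a0| <= B * (2 * rho `^ alpha).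
  apply: (le_trans Ha1); rewrite ler_wpM2l // mulr_natl mulr2n lerD //;
    by rewrite ge0_ler_powR ?nnegrE ?sqrtr_ge0 // ltW.
have -> : Phi s (x + z + y) - ((a s (x + z) - a0) * lap (psi s) (x + z) + g s (x + z))
  = (a s (x + z + y) - a s (x + z)) * lap (psi s) (x + z + y)
    + (a s (x + z) - a0) * (lap (psi s) (x + z + y) - lap (psi s) (x + z))
    + (g s (x + z + y) - g s (x + z)) by rewrite /Phi; ring.
apply: (@le_trans _ _ (K * d y `^ alpha)); last first.
  by rewrite ler_wpM2l // lerDr powR_ge0.
apply: (@le_trans _ _ ((B * (nD * M) + Ga + 2 * B * rho `^ alpha * (nn * (nD * S)))
   * d y `^ alpha)); last by rewrite ler_wpM2r ?powR_ge0.
apply: (le_trans (ler_normD _ _)).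
rewrite [leRHS](_ : _ = B * d y `^ alpha * (nD * M)
  + B * (2 * rho `^ alpha) * (nn * (nD * S) * d y `^ alpha)
  + Ga * d y `^ alpha); last by ring.
rewrite lerD //; apply: (le_trans (ler_normD _ _)); rewrite !normrM lerD //.
  by rewrite ler_pM.
by rewrite ler_pM.
Qed.

Let wc_ge0 m : 0 <= weighted_cst kappa cm cp m.
Proof. exact: sqrtr_ge0. Qed.

Let alpha01' : 0 < alpha <= 1.
Proof. by case/andP: alpha01 => -> /ltW. Qed.

Let sq_ts s : s < t -> Num.sqrt (t - s) ^+ 2 = t - s.
Proof. by move=> st; rewrite sqr_sqrtr // subr_ge0 ltW. Qed.

Let Z_bound es y s b K' : 0 <= s < t -> (0 < size es)%N -> 0 <= K' ->
  (forall v, `|Phi s (y + v) - b| <=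
     K' * (Num.sqrt (t - s) `^ alpha + d v `^ alpha)) ->
  `|foldr dq (heat (a0 * (t - s)) (Phi s)) es y| <=
    K' * weighted_cst kappa cm cp (size es) *
      (Num.sqrt (t - s) `^ alpha / Num.sqrt (t - s) ^+ size es).
Proof.
move=> /andP[s0 st] es0 K'0 H.
rewrite -(foldr_dq_heat_subcst _ _ b) // -{1}(sq_ts st).
apply: (weighted_estimate opK sh_op d0 d_ge0 lap_d) => //.
by rewrite sqrtr_gt0 subr_gt0.
Qed.

(** Here the two points are estimated separately, each with its own centre, and nothing is gained
    from their difference. *)
Let Z_near s : 0 <= s < t -> t - s <= rho ^+ 2 ->
  `|Z s (x + z) - Z s x| <= 2 * K * C * (t - s) `^ (alpha / 2 - 1).
Proof.
move=> sst srho; have /andP[s0 st] := sst.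
have sst' : 0 <= s <= t by rewrite s0 ltW.
have sr : Num.sqrt (t - s) <= rho.
  by rewrite -[rho]ger0_norm ?(ltW rho_gt0) // -sqrtr_sqr ler_wsqrtr.
have H1 := @Z_bound [:: e'; e] (x + z) s _ K sst isT K_ge0
  (fun v => Phi_near v sst' sr).
have H2 := @Z_bound [:: e'; e] x s _ K sst isT K_ge0 (fun v =>
  le_trans (Phi_center v sst') (ler_wpM2r (addr_ge0 (powR_ge0 _ _) (powR_ge0 _ _)) K1_le)).
move: H1 H2; rewrite powR_sqrt_div ?subr_gt0 // (divff (_ : 2 != 0)) //.
rewrite -/(Z _ _) -/(Z _ _) /=.
set P := (t - s) `^ _; have P0 : 0 <= P by exact: powR_ge0.
move=> H1 H2; apply: (le_trans (ler_normB _ _)).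
apply: (le_trans (lerD H1 H2)).
rewrite [leRHS](_ : _ = K * C * P + K * C * P); last by ring.
by rewrite lerD // ler_wpM2r // ler_wpM2l // lerDl.
Qed.

(** The walk from [x] to [x + z] is telescoped into third differences. All its points lie within
    [sqrt (t - s)] of [x], so the source can stay centred at [x] and [S] does not enter. *)
Let Z_far s : 0 <= s < t -> rho ^+ 2 <= t - s ->
  `|Z s (x + z) - Z s x| <= 4 * K * C * rho * (t - s) `^ ((alpha - 1) / 2 - 1).
Proof.
move=> sst srho; have /andP[s0 st] := sst.
have sst' : 0 <= s <= t by rewrite s0 ltW.
have sr : rho <= Num.sqrt (t - s).
  by rewrite -[rho]ger0_norm ?(ltW rho_gt0) // -sqrtr_sqr ler_wsqrtr.
have a01 : 0 < alpha by case/andP: alpha01.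
set P := (t - s) `^ _; have P0 : 0 <= P by exact: powR_ge0.
rewrite [leRHS](_ : _ = k%:R / c * (4 * K * C * P)); last by rewrite /rho; ring.
apply: dq_telescope => j jk.
have jrho : j%:R / c <= rho.
  by rewrite ler_wpM2r ?invr_ge0 ?(ltW c_gt0) // ler_nat ltnW.
(* Moving the centre by at most [sqrt (t - s)] changes the weight by a bounded factor, rounded up to
   [4]. *)
have H v : `|Phi s (x + sh l *+ j + v) - g s x| <=
   (4 * K) * (Num.sqrt (t - s) `^ alpha + d v `^ alpha).
  have -> : x + sh l *+ j + v = x + (v + sh l *+ j) by rewrite [v + _]addrC addrA.
  apply: (le_trans (Phi_center _ sst')).
  have dv : d (v + sh l *+ j) <= d v + Num.sqrt (t - s).
    by apply: (le_trans (d_steps _ _ _)); rewrite lerD2l (le_trans jrho).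
  have H0 : d (v + sh l *+ j) `^ alpha <=
      2 * (d v `^ alpha + Num.sqrt (t - s) `^ alpha).
    apply: (le_trans _ (powRD_le (d_ge0 v) (sqrtr_ge0 (t - s)) alpha01')).
    by rewrite ge0_ler_powR ?nnegrE ?addr_ge0 ?sqrtr_ge0 // ltW.
  move: (powR_ge0 (d v) alpha) (powR_ge0 (Num.sqrt (t - s)) alpha) H0.
  set p1 := d v `^ _; set p2 := Num.sqrt _ `^ _; set p3 := d _ `^ _ => p10 p20 H0.
  apply: (@le_trans _ _ (K * (4 * (p2 + p1)))); last by rewrite mulrCA mulrA.
  apply: ler_pM => //; first by rewrite addr_ge0 // mulr_ge0 // mulr_ge0.
  - by rewrite addr_ge0 // powR_ge0.
  - lra.
have := @Z_bound [:: l; e'; e] (x + sh l *+ j) s _ (4 * K) sst isT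
  (mulr_ge0 (ler0n _ 4) K_ge0) H.
rewrite powR_sqrt_div ?subr_gt0 //=.
have -> : alpha / 2 - 3 / 2 = (alpha - 1) / 2 - 1 by field.
move=> H1; apply: (le_trans H1).
apply: ler_wpM2r => //; apply: ler_wpM2l; first by rewrite mulr_ge0.
by rewrite /C lerDr.
Qed.

Let U s := heat (a0 * (t - s)) (hess e e' s) (x + z) - heat (a0 * (t - s)) (hess e e' s) x.

Let is_derive_U s : 0 < s < t -> is_derive s 1 U (Z s (x + z) - Z s x).
Proof.
move=> /andP[s0 st]; have sT : 0 < s < T by rewrite s0 (lt_le_trans st).
have Dh y : is_derive s 1 (fun s => hess e e' s y)
    (dq e' (dq e (fun y => a s y * lap (psi s) y + g s y)) y).
  by apply: is_derive_scale; apply: is_derive_sub; exact: is_derive_dq_psi.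
have DH v := is_derive_duhamel c opK sh_op (u := hess e e')
  (du := fun s => dq e' (dq e (fun y => a s y * lap (psi s) y + g s y))) a0 t v Dh.
have E v : heat (a0 * (t - s)) (fun y =>
    dq e' (dq e (fun y => a s y * lap (psi s) y + g s y)) y
    - a0 * lap (hess e e' s) y) v = Z s v.
  rewrite /Z /=.
  have -> : dq e (heat (a0 * (t - s)) (Phi s)) = heat (a0 * (t - s)) (dq e (Phi s)).
    by apply/funext => y; rewrite heat_dq.
  rewrite -heat_dq; apply: heat_ext => y.
  have -> : hess e e' s = dq e' (dq e (psi s)) by [].
  rewrite lap_dq /dq !(lap_dq sh c e (psi s)) /dq /Phi; ring.
have := is_derive_sub (DH (x + z)) (DH x).
by rewrite !E.
Qed.

Let continuous_U : {within `[0, t], continuous U}.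
Proof.
have ch y : {within `[0, t], continuous (fun s => hess e e' s y)}.
  apply: (@continuous_subspaceW _ _ _ `[0, T]).
    by move=> s /=; rewrite !in_itv /= => /andP[-> /le_trans]; apply.
  by apply: within_continuous_scale; apply: within_continuous_sub; exact: continuous_dq_psi.
have cH v : {within `[0, t], continuous (fun s => heat (a0 * (t - s)) (hess e e' s) v)}.
  apply: within_continuous_fsum => y.
  apply: (@within_continuous_mul R (fun s => heat_kernel sh c (a0 * (t - s)) y)
    (fun s => hess e e' s (v + y))); last exact: ch.
  have Dk s := is_derive_reflect (is_derive_heat_kernel sh c (a0 * (t - s)) y).
  exact: (continuous_subspaceT (is_derive_continuous Dk)).
exact: within_continuous_sub.
Qed.

Let C_ge0 : 0 <= C. Proof. by rewrite addr_ge0. Qed.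

Let increment_near s : 0 <= s < t -> t - s <= rho ^+ 2 ->
  `|U t - U s| <= 4 / alpha * K * C * rho `^ alpha.
Proof.
move=> /andP[s0 st] srho; have a01 : 0 < alpha by case/andP: alpha01.
(* [- L * (t - r)^(alpha / 2)] is a primitive of the bound in [Z_near], and it vanishes at
   [r = t]. *)
pose L := 4 / alpha * K * C.
have L0 : 0 <= L.
  by apply: mulr_ge0 => //; apply: mulr_ge0 => //; rewrite divr_ge0 // ltW.
have := @ler_norm_derive_increment R U (fun r => - L * (t - r) `^ (alpha / 2))
  (fun r => Z r (x + z) - Z r x)
  (fun r => - L * (- (alpha / 2) * (t - r) `^ (alpha / 2 - 1))) s t (ltW st).
rewrite subrr powR0 ?mulr0 ?sub0r; last by rewrite gt_eqF // divr_gt0.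
rewrite mulNr opprK => H; apply: (le_trans (H _ _ _ _ _)).
- apply: (continuous_subspaceW _ continuous_U) => r /=.
  by rewrite !in_itv /= => /andP[/(le_trans s0) -> ->].
- apply: within_continuous_scale; apply: within_continuous_powR_reflect; first exact: ltW.
  by rewrite divr_gt0.
- move=> r /andP[sr rt]; apply: is_derive_U; by rewrite rt (le_lt_trans s0).
- move=> r /andP[sr rt]; apply: is_derive_scale; exact: is_derive_powR_reflect.
- move=> r /andP[sr rt].
  have -> : - L * (- (alpha / 2) * (t - r) `^ (alpha / 2 - 1)) =
      2 * K * C * (t - r) `^ (alpha / 2 - 1).
    by rewrite /L; field; rewrite gt_eqF.
  apply: Z_near; first by rewrite rt (le_trans s0) // ltW.
  by apply: (le_trans _ srho); rewrite lerD2l lerN2 ltW.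
rewrite ler_wpM2l // -[rho]sqr_sqrtr ?(ltW rho_gt0) //.
rewrite -powR_sqrt_half ?subr_ge0 ?(ltW st) //.
rewrite ge0_ler_powR ?nnegrE ?sqr_ge0 ?sqrtr_ge0 ?(ltW a01) //.
rewrite sqr_sqrtr ?(ltW rho_gt0) //.
by rewrite -[rho]ger0_norm ?(ltW rho_gt0) // -sqrtr_sqr ler_wsqrtr.
Qed.

Let increment_far s : 0 <= s < t -> t - s = rho ^+ 2 ->
  `|U s - U 0| <= 8 / (1 - alpha) * K * C * rho `^ alpha.
Proof.
move=> /andP[s0 st] srho; have /andP[a01 a1] := alpha01.
(* The primitive of the bound in [Z_far] has a negative exponent: its value at time [0] is dropped,
   and at [t - s = rho^2] it contributes [rho * (rho^2)^((alpha - 1)/2) = rho^alpha]. *)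
pose L := 8 / (1 - alpha) * K * C * rho.
have a1' : 0 < 1 - alpha by rewrite subr_gt0.
have L0 : 0 <= L.
  apply: mulr_ge0 (ltW rho_gt0); apply: mulr_ge0 => //; apply: mulr_ge0 => //.
  by rewrite divr_ge0 // ltW.
have DhP r : 0 < t - r -> is_derive r 1 (fun r => L * (t - r) `^ ((alpha - 1) / 2))
    (L * (- ((alpha - 1) / 2) * (t - r) `^ ((alpha - 1) / 2 - 1))).
  by rewrite subr_gt0 => rt; apply: is_derive_scale; exact: is_derive_powR_reflect.
have := @ler_norm_derive_increment R U (fun r => L * (t - r) `^ ((alpha - 1) / 2))
  (fun r => Z r (x + z) - Z r x)
  (fun r => L * (- ((alpha - 1) / 2) * (t - r) `^ ((alpha - 1) / 2 - 1))) 0 s s0.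
move=> H; apply: (le_trans (H _ _ _ _ _)).
- apply: (continuous_subspaceW _ continuous_U) => r /=.
  by rewrite !in_itv /= => /andP[-> /le_trans]; apply; exact: ltW.
- apply: derivable_within_continuous => r; rewrite in_itv /= => /andP[_ rs].
  have rt : 0 < t - r by rewrite subr_gt0 (le_lt_trans rs).
  by case: (DhP r rt).
- move=> r /andP[r0 rs]; apply: is_derive_U; by rewrite r0 (lt_trans rs).
- by move=> r /andP[r0 rs]; apply: DhP; rewrite subr_gt0 (lt_trans rs).
- move=> r /andP[r0 rs].
  have -> : L * (- ((alpha - 1) / 2) * (t - r) `^ ((alpha - 1) / 2 - 1)) =
      4 * K * C * rho * (t - r) `^ ((alpha - 1) / 2 - 1).
    by rewrite /L; field; rewrite gt_eqF.
  apply: Z_far; first by rewrite ltW // (lt_trans rs).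
  by rewrite -srho lerD2l lerN2 ltW.
rewrite srho; apply: (@le_trans _ _ (L * (rho ^+ 2) `^ ((alpha - 1) / 2))).
  by rewrite gerBl mulr_ge0 // powR_ge0.
rewrite -powR_mulrn ?(ltW rho_gt0) // -powRrM [_ * (_ / 2)]mulrC divfK //.
by rewrite /L -[X in X <= _]mulrA mulr_powRB1 // ltW.
Qed.

Lemma hess_increment :
  `|hess e e' t (x + sh l *+ k) - hess e e' t x| <=
    (I + 2 * freezing_cst * (B * M + Ga + B * (k%:R / c) `^ alpha * S))
      * (k%:R / c) `^ alpha.
Proof.
have /andP[a01 a1] := alpha01.
have a1' : 0 < 1 - alpha by rewrite subr_gt0.
have -> : hess e e' t (x + sh l *+ k) - hess e e' t x = U t.
  by rewrite /U subrr mulr0 !heat0.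
have U0 : `|U 0| <= I * rho `^ alpha.
  rewrite /U subr0 -heat_shift.
  have -> : heat (a0 * t) (fun y => hess e e' 0 (y + z)) x - heat (a0 * t) (hess e e' 0) x =
     heat (a0 * t) (fun y => hess e e' 0 (y + z) - hess e e' 0 y) x.
    by rewrite /heat -sumrB; apply: eq_bigr => y _; rewrite mulrBr.
  by apply: heat_norm_le => [|y]; [rewrite mulr_ge0 // ltW|exact: I_bound].
have main : `|U t - U 0| <= (4 / alpha + 8 / (1 - alpha)) * K * C * rho `^ alpha.
  have KC : 0 <= K * C * rho `^ alpha.
    by apply: mulr_ge0 => //; exact: mulr_ge0.
  have [tr|tr] := leP t (rho ^+ 2).
    apply: (le_trans (increment_near _ _)); rewrite ?lexx ?subr0 //.
    rewrite [leRHS](_ : _ = 4 / alpha * K * C * rho `^ alpha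
      + 8 / (1 - alpha) * (K * C * rho `^ alpha)); last by ring.
    by rewrite lerDl; apply: mulr_ge0 => //; rewrite divr_ge0 // ltW.
  pose s := t - rho ^+ 2.
  have ss : 0 <= s < t.
    by rewrite subr_ge0 ltW //= gtrBl exprn_gt0.
  have ts : t - s = rho ^+ 2 by rewrite /s; ring.
  rewrite (_ : U t - U 0 = (U t - U s) + (U s - U 0)); last by ring.
  apply: (le_trans (ler_normD _ _)).
  rewrite [leRHS](_ : _ = 4 / alpha * K * C * rho `^ alpha
    + 8 / (1 - alpha) * K * C * rho `^ alpha); last by ring.
  apply: lerD; last exact: increment_far.
  by apply: increment_near => //; rewrite ts.
rewrite (_ : U t = U 0 + (U t - U 0)); last by ring.
apply: (le_trans (ler_normD _ _)); rewrite [leRHS]mulrDl lerD //; apply: (le_trans main).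
rewrite ler_wpM2r // /freezing_cst -/Q -/C.
rewrite [leRHS](_ : _ = 2 * (4 / alpha + 4 / (1 - alpha)) * K * C); last by rewrite /K /rho; ring.
rewrite -2!mulrA; apply: ler_wpM2r; first exact: mulr_ge0.
have : 0 <= alpha^-1 by rewrite invr_ge0 ltW.
lra.
Qed.

End Increment.
Lemma freezing_cst_ge0 : 0 <= freezing_cst.
Proof.
have /andP[a01 a1] := alpha01.
rewrite /freezing_cst; apply: mulr_ge0.
  apply: mulr_ge0; last by rewrite addr_ge0 // sqrtr_ge0.
  by rewrite !addr_ge0 // !mulr_ge0.
by rewrite addr_ge0 // divr_ge0 // ?subr_ge0 ltW.
Qed.

(** Valid below the mesh as well: if [eta < c^-1], then [k = 1] and only [j = 0] has to be within
    [eta]. *)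
Lemma steps_above_scale (eta : R) : 0 < eta ->
  exists2 k, (0 < k)%N &
    eta <= k%:R / c /\ forall j, (j < k)%N -> j%:R / c <= eta.
Proof.
move=> eta0; have ec : 0 <= eta * c by rewrite mulr_ge0 // ltW.
exists (Num.truncn (eta * c)).+1 => //; split => [|j].
  by rewrite ler_pdivlMr // ltW // truncnS_gt.
rewrite ltnS => jk; rewrite ler_pdivrMr //.
apply: (@le_trans _ _ (Num.truncn (eta * c))%:R); first by rewrite ler_nat.
by rewrite truncn_le.
Qed.

Definition hess_holder_bound (S : R) := forall e e' l k x t, 0 <= t <= T ->
  `|hess e e' t (x + sh l *+ k) - hess e e' t x| <= S * (k%:R / c) `^ alpha.

(** * Interpolation and absorption of the Hölder seminorm *)

Variables (W I : R).
Hypothesis I_ge0 : 0 <= I.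
Hypothesis W_bound : forall e t x, 0 <= t <= T -> `|dq e (psi t) x| <= W.
Hypothesis hess0_holder : forall e e' l k x,
  `|hess e e' 0 (x + sh l *+ k) - hess e e' 0 x| <= I * (k%:R / c) `^ alpha.

Lemma hess_interpolation S r e e' t x : 0 <= t <= T -> 0 < r -> 0 <= S ->
  hess_holder_bound S -> `|hess e e' t x| <= S * r `^ alpha + 2 * W / r.
Proof.
move=> tT r0 S0 HS; have /andP[a01 a1] := alpha01.
have [k k0 [rk jr]] := steps_above_scale r0.
have rho0 : 0 < k%:R / c := lt_le_trans r0 rk.
have W0 : 0 <= W by apply: le_trans (W_bound e x tT).
have := @dq_average (dq e (psi t)) e' k x (hess e e' t x) (S * r `^ alpha).
have H1 j : (j < k)%N ->
    `|dq e' (dq e (psi t)) (x + sh e' *+ j) - hess e e' t x| <= S * r `^ alpha.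
  move=> jk; apply: (le_trans (HS e e' e' j x t tT)); rewrite ler_wpM2l //.
  rewrite ge0_ler_powR ?nnegrE ?(ltW a01) ?(ltW r0) //; last exact: jr.
  by rewrite divr_ge0 // ltW.
move=> /(_ H1); set q := dq e (psi t) _ - _ => H.
have Hq : `|q| <= 2 * W.
  rewrite mulr_natl mulr2n; apply: (le_trans (ler_normB _ _)).
  by rewrite lerD // W_bound.
have {}H : k%:R / c * `|hess e e' t x| <= k%:R / c * (S * r `^ alpha) + 2 * W.
  rewrite -{1}(ger0_norm (ltW rho0)) -normrM.
  move: H Hq; set p := _ * hess _ _ _ _.
  have := ler_normB q (q - p); rewrite opprB addrC subrK; lra.
have {H} : `|hess e e' t x| <= S * r `^ alpha + 2 * W / (k%:R / c).
  by rewrite -(ler_pM2l rho0) mulrDr [X in _ + X]mulrC divfK ?gt_eqF.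
move=> /le_trans; apply; rewrite lerD2l ler_wpM2l ?mulr_ge0 //.
by rewrite lef_pV2 // posrE.
Qed.

(** The displacements are split at [8 * freezing_cst * B * rho^alpha = 1]. Below, [hess_increment]
    returns at most [S / 4] from the seminorm and [S / 16] from the interpolated [M]. Above, the
    trivial bound [2 * M], multiplied by a factor larger than [1], returns [S / 2]. Any total below
    [S] allows absorption. *)
Lemma hess_holder_improve S r : 0 < r -> 0 <= S ->
  32 * freezing_cst * B * r `^ alpha <= 1 -> hess_holder_bound S ->
  hess_holder_bound (I + 2 * freezing_cst * Ga + 32 * freezing_cst * B * W / r
    + 3 / 4 * S).
Proof.
move=> r0 S0; set A := freezing_cst => Ar HS e e' l k x t tT.
have A0 : 0 <= A := freezing_cst_ge0.
have W0 : 0 <= W by apply: le_trans (W_bound e x tT).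
set rho := k%:R / c; set p := rho `^ alpha.
have p0 : 0 <= p by exact: powR_ge0.
set V0 := B * W / r.
have V00 : 0 <= V0 by rewrite /V0 !mulr_ge0 // invr_ge0 ltW.
have AG : 0 <= A * Ga by exact: mulr_ge0.
have AV : 0 <= A * V0 by exact: mulr_ge0.
rewrite [X in I + _ + X](_ : _ = 32 * (A * V0)); last by rewrite /V0; ring.
rewrite -[X in I + X]mulrA.
set M := S * r `^ alpha + 2 * W / r.
have HM e1 e2 s y : 0 <= s <= T -> `|hess e1 e2 s y| <= M.
  by move=> sT; exact: hess_interpolation.
have M0 : 0 <= M by apply: le_trans (HM e e t x tT).
have BM : B * M = B * r `^ alpha * S + 2 * V0 by rewrite /M /V0; ring.
have ABr : 32 * (A * (B * M)) <= S + 64 * (A * V0).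
  rewrite BM; have : (32 * A * B * r `^ alpha) * S <= 1 * S by rewrite ler_wpM2r.
  lra.
have [k0|k0] := posnP k.
  rewrite k0 mulr0n addr0 subrr normr0; apply: mulr_ge0 => //.
  by move: I_ge0; lra.
have [t0|t0] := leP t 0.
  have -> : t = 0 by apply/eqP; rewrite eq_le t0; case/andP: tT.
  apply: (le_trans (hess0_holder _ _ _ _ _)); rewrite ler_wpM2r //.
  lra.
have tT' : 0 < t <= T by rewrite t0; case/andP: tT.
have := hess_increment x k0 tT' HM S0
  (fun e1 e2 s l k y => HS e1 e2 l k y s) (hess0_holder e e' l k).
rewrite -/A -/rho -/p => H.
have [small|large] := leP (8 * A * B * p) 1.
  apply: (le_trans H); rewrite ler_wpM2r //.
  have : (8 * A * B * p) * S <= 1 * S by rewrite ler_wpM2r.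
  lra.
have H2 : `|hess e e' t (x + sh l *+ k) - hess e e' t x| <= 2 * M.
  rewrite mulr_natl mulr2n; apply: (le_trans (ler_normB _ _)).
  by rewrite lerD // HM.
apply: (le_trans H2); apply: (@le_trans _ _ (2 * M * (8 * A * B * p))).
  by rewrite ler_peMr ?mulr_ge0 // ltW.
rewrite [leLHS](_ : _ = 16 * (A * (B * M)) * p); last by ring.
rewrite ler_wpM2r //; move: I_ge0 AG S0 ABr; lra.
Qed.

(* The optimal constant satisfies [S <= K + 3/4 S] and is finite because the
   lattice is. *)
Lemma hess_holder r : 0 < r -> 32 * freezing_cst * B * r `^ alpha <= 1 ->
  hess_holder_bound
    (4 * (I + 2 * freezing_cst * Ga + 32 * freezing_cst * B * W / r)).
Proof.
move=> r0 Ar; have /andP[a01 a1] := alpha01.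
set K := I + _ + _ => e0 e0' l0 k0 x0 t0 t0T.
have [k00|k0_gt0] := posnP k0.
  have W0 : 0 <= W by apply: le_trans (W_bound e0 x0 t0T).
  have A0 := freezing_cst_ge0.
  have AB : 0 <= freezing_cst * B * W / r.
    apply: mulr_ge0; last by rewrite invr_ge0 ltW.
    by apply: mulr_ge0 => //; exact: mulr_ge0.
  have AG := mulr_ge0 A0 Ga_ge0.
  rewrite k00 mulr0n addr0 subrr normr0 mulr_ge0 ?powR_ge0 // /K.
  by move: I_ge0; lra.
have pos k : (0 < k)%N -> 0 < (k%:R / c) `^ alpha.
  by move=> k1; rewrite powR_gt0 // divr_gt0 // ltr0n.
pose E := [set v | exists e e' l k x t, [/\ (0 < k)%N, 0 <= t <= T &
  v = `|hess e e' t (x + sh l *+ k) - hess e e' t x| / (k%:R / c) `^ alpha]].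
have W0 : 0 <= W by apply: le_trans (W_bound e0 x0 t0T).
(* This bound degenerates with the mesh; it only ensures that [sup E] is finite and does not enter
   the final constant. *)
have Ebd : ubound E (4 * c * W / (1%:R / c) `^ alpha).
  move=> _ [e [e' [l [k [x [t [k1 tT ->]]]]]]].
  have H y : `|hess e e' t y| <= 2 * c * W.
    rewrite /hess /dq normrM (ger0_norm (ltW c_gt0)) mulrAC mulrC.
    rewrite ler_wpM2r ?(ltW c_gt0) // mulr_natl mulr2n.
    by apply: (le_trans (ler_normB _ _)); rewrite lerD // W_bound.
  have p1 := pos 1%N isT; have pk := pos k k1.
  apply: ler_pM => //; first by rewrite invr_ge0 ltW.
    apply: (le_trans (ler_normB _ _)); move: (H x) (H (x + sh l *+ k)); lra.
  rewrite lef_pV2 ?posrE // ge0_ler_powR ?nnegrE ?divr_ge0 ?(ltW c_gt0) ?(ltW a01) //.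
  by rewrite ler_wpM2r ?invr_ge0 ?(ltW c_gt0) // ler_nat.
have E0 : E !=set0.
  by exists (`|hess e0 e0' t0 (x0 + sh l0 *+ k0) - hess e0 e0' t0 x0| / (k0%:R / c) `^ alpha);
    exists e0, e0', l0, k0, x0, t0.
have Esup : has_sup E by split => //; exists (4 * c * W / (1%:R / c) `^ alpha).
have S0 : 0 <= sup E.
  case: E0 => v Ev; apply: (@le_trans _ _ v); last exact: ub_le_sup (proj2 Esup) _ Ev.
  by case: Ev => e [e' [l [k [x [t [_ _ ->]]]]]]; rewrite divr_ge0 // powR_ge0.
have HS : hess_holder_bound (sup E).
  move=> e e' l k x t tT; have [k1|k1] := posnP k.
    by rewrite k1 mulr0n addr0 subrr normr0 mulr_ge0 // powR_ge0.
  rewrite -ler_pdivrMr ?pos //; apply: ub_le_sup; first exact: (proj2 Esup).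
  by exists e, e', l, k, x, t.
have le_S : sup E <= K + 3 / 4 * sup E.
  apply: ge_sup => // _ [e [e' [l [k [x [t [k1 tT ->]]]]]]].
  rewrite ler_pdivrMr ?pos //; exact: hess_holder_improve.
apply: (le_trans (HS e0 e0' l0 k0 x0 t0 t0T)); rewrite ler_wpM2r ?powR_ge0 //.
lra.
Qed.

(** * Time regularity of the Hessian and of the gradient *)

Section TimeRegularity.
Variables (M S : R).
Hypothesis M_bound : forall e e' s y, 0 <= s <= T -> `|hess e e' s y| <= M.
Hypothesis S_ge0 : 0 <= S.
Hypothesis S_bound : hess_holder_bound S.

Let F t y := a t y * lap (psi t) y + g t y.
Let H : R := B * (nD * M) + cp * (nD * S) + Ga.

Let F_holder t e k y : 0 <= t <= T ->
  `|F t (y + sh e *+ k) - F t y| <= H * (k%:R / c) `^ alpha.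
Proof.
move=> tT; have /andP[a01 a1] := alpha01.
have dk : d (sh e *+ k) `^ alpha <= (k%:R / c) `^ alpha.
  rewrite ge0_ler_powR ?nnegrE ?(ltW a01) ?divr_ge0 ?(ltW c_gt0) //.
  by have := d_steps 0 e k; rewrite d0 !add0r.
have Ha : `|a t (y + sh e *+ k) - a t y| <= B * (k%:R / c) `^ alpha.
  have := a_holder y (sh e *+ k) tT tT.
  rewrite subrr normr0 powR0 ?add0r; last by rewrite gt_eqF // divr_gt0.
  by move=> /le_trans; apply; rewrite ler_wpM2l.
have Hg : `|g t (y + sh e *+ k) - g t y| <= Ga * (k%:R / c) `^ alpha.
  by apply: (le_trans (g_holder _ _ tT)); rewrite ler_wpM2l.
have Hw : `|lap (psi t) (y + sh e *+ k) - lap (psi t) y| <=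
    nD * (S * (k%:R / c) `^ alpha).
  by apply: lap_increment => e1 y1; exact: S_bound.
have Hwb : `|lap (psi t) (y + sh e *+ k)| <= nD * M.
  by apply: lap_bound => e1 y1; exact: M_bound.
have Hab : `|a t y| <= cp.
  have /andP[h1 h2] := a_bound y tT; rewrite ger0_norm // (le_trans (ltW cm_gt0)) //.
have -> : F t (y + sh e *+ k) - F t y =
  (a t (y + sh e *+ k) - a t y) * lap (psi t) (y + sh e *+ k)
  + a t y * (lap (psi t) (y + sh e *+ k) - lap (psi t) y)
  + (g t (y + sh e *+ k) - g t y) by rewrite /F; ring.
set p := (k%:R / c) `^ alpha in dk Ha Hg Hw *.
rewrite [leRHS](_ : _ = B * p * (nD * M) + cp * (nD * (S * p)) + Ga * p); last first.
  by rewrite /H; ring.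
apply: (le_trans (ler_normD _ _)); apply: lerD => //.
apply: (le_trans (ler_normD _ _)); rewrite !normrM; apply: lerD; exact: ler_pM.
Qed.

(** Although [psi] alone need not be differentiable in time, its increments along a walk are sums of
    the quotients that are. *)
Let is_derive_steps e k x t : 0 < t < T ->
  is_derive t 1 (fun s => psi s (x + sh e *+ k) - psi s x)
    (F t (x + sh e *+ k) - F t x).
Proof.
move=> tT; elim: k => [|k IH].
  rewrite mulr0n addr0 subrr.
  have -> : (fun s => psi s x - psi s x) = (fun=> 0) by apply/funext => s; rewrite subrr.
  exact: is_derive_cst.
have := is_derive_add (is_derive_scale c^-1 (is_derive_dq_psi e (x + sh e *+ k) tT)) IH.
rewrite /dq !mulKf ?gt_eqF // -!addrA -!mulrSr.
have -> : (fun s => c^-1 * (c * (psi s (x + sh e *+ k.+1) - psi s (x + sh e *+ k)))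
   + (psi s (x + sh e *+ k) - psi s x)) = (fun s => psi s (x + sh e *+ k.+1) - psi s x).
  by apply/funext => s; rewrite mulKf ?gt_eqF //; ring.
by move=> /is_derive_eq; apply; rewrite /F; ring.
Qed.

Let continuous_steps e k x :
  {within `[0, T], continuous (fun s => psi s (x + sh e *+ k) - psi s x)}.
Proof.
elim: k => [|k IH].
  rewrite mulr0n addr0.
  have -> : (fun s => psi s x - psi s x) = (fun=> 0) by apply/funext => s; rewrite subrr.
  by move=> s; exact: cvg_cst.
have -> : (fun s => psi s (x + sh e *+ k.+1) - psi s x) =
  (fun s => c^-1 * dq e (psi s) (x + sh e *+ k) - (psi s x - psi s (x + sh e *+ k))).
  by apply/funext => s; rewrite /dq mulKf ?gt_eqF // mulrSr addrA; ring.
apply: within_continuous_sub; first by apply: within_continuous_scale; exact: continuous_dq_psi.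
have -> : (fun s => psi s x - psi s (x + sh e *+ k)) =
  (fun s => -1 * (psi s (x + sh e *+ k) - psi s x)) by apply/funext => s; ring.
exact: within_continuous_scale.
Qed.

Let lipschitz_increment (q q' : R -> R) (L s t : R) : 0 <= s -> s <= t -> t <= T ->
  {within `[0, T], continuous q} ->
  (forall r, 0 < r < T -> is_derive r 1 q (q' r)) ->
  (forall r, 0 < r < T -> `|q' r| <= L) -> `|q t - q s| <= L * (t - s).
Proof.
move=> s0 st tT cq Dq HL; rewrite mulrBr.
have sub r : s < r < t -> 0 < r < T.
  by move=> /andP[sr rt]; rewrite (le_lt_trans s0) //= (lt_le_trans rt).
have DL (r : R) : is_derive r 1 (fun r : R => L * r) (L * 1) by exact: is_derive_scale.
apply: (@ler_norm_derive_increment R q (fun r : R => L * r) q' (fun=> L * 1) s t st).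
- apply: (continuous_subspaceW _ cq) => r /=.
  by rewrite !in_itv /= => /andP[/(le_trans s0) -> /le_trans]; apply.
- exact: (continuous_subspaceT (is_derive_continuous DL)).
- by move=> r /sub; exact: Dq.
- by move=> r /sub; rewrite mulr1; exact: HL.
Qed.

Let H_ge0 (x : V) t (e : D) : 0 <= t <= T -> 0 <= H.
Proof.
move=> tT; have M0 : 0 <= M by apply: le_trans (M_bound e e x tT).
have /andP[h1 h2] := a_bound x tT; have cp0 := le_trans (ltW cm_gt0) (le_trans h1 h2).
by rewrite /H !addr_ge0 // !mulr_ge0.
Qed.

(** The mixed difference over a [k] by [k] box is [rho^2] times the Hessian, with error
    [2 * S * rho^2 * eta^alpha] at each of the two times. Between these times it moves by at most
    [2 * H * rho^alpha * eta^2], the Hölder bound for [F] used twice. Dividing by [rho^2] with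
    [rho >= eta] gives [2 * H + 4 * S]. *)
Let hess_time_le e e' t s x : 0 <= s -> s < t -> t <= T ->
  `|hess e e' t x - hess e e' s x| <=
    (2 * H + 4 * S) * Num.sqrt (t - s) `^ alpha.
Proof.
move=> s0 st tT; have /andP[a01 a1] := alpha01.
have sT : 0 <= s <= T by rewrite s0 (le_trans (ltW st)).
have tT' : 0 <= t <= T by rewrite tT (le_trans s0 (ltW st)).
have eta0 : 0 < Num.sqrt (t - s) by rewrite sqrtr_gt0 subr_gt0.
have eta2 : t - s = Num.sqrt (t - s) ^+ 2 by rewrite sqr_sqrtr // subr_ge0 ltW.
set eta := Num.sqrt (t - s) in eta0 eta2 *.
have [k k0 [etak jeta]] := steps_above_scale eta0.
set rho := k%:R / c in etak.
have rho0 : 0 < rho := lt_le_trans eta0 etak.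
pose E r y := psi r (y + sh e *+ k) - psi r y.
have close r : 0 <= r <= T ->
    `|E r (x + sh e' *+ k) - E r x - rho * (rho * hess e e' r x)| <=
      rho * (rho * (2 * S * eta `^ alpha)).
  move=> rT; apply: dq_average => j jk.
  have -> : dq e' (E r) (x + sh e' *+ j) =
      dq e' (psi r) (x + sh e' *+ j + sh e *+ k) - dq e' (psi r) (x + sh e' *+ j).
    by rewrite /E /dq !(addrAC _ (sh e *+ k)); ring.
  apply: dq_average => i ik.
  have -> : dq e (dq e' (psi r)) (x + sh e' *+ j + sh e *+ i) =
      hess e e' r (x + sh e' *+ j + sh e *+ i).
    by rewrite /hess /dq !(addrAC _ (sh e)); ring.
  have lej m l : (m < k)%N -> `|hess e e' r (l + sh e' *+ m) - hess e e' r l| <= S * eta `^ alpha.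
    move=> mk; apply: (le_trans (S_bound _ _ _ _ _ rT)); rewrite ler_wpM2l //.
    by rewrite ge0_ler_powR ?nnegrE ?(ltW a01) ?(ltW eta0) ?divr_ge0 ?(ltW c_gt0) ?jeta.
  have lei m l : (m < k)%N -> `|hess e e' r (l + sh e *+ m) - hess e e' r l| <= S * eta `^ alpha.
    move=> mk; apply: (le_trans (S_bound _ _ _ _ _ rT)); rewrite ler_wpM2l //.
    by rewrite ge0_ler_powR ?nnegrE ?(ltW a01) ?(ltW eta0) ?divr_ge0 ?(ltW c_gt0) ?jeta.
  rewrite (_ : _ - _ = (hess e e' r (x + sh e' *+ j + sh e *+ i) - hess e e' r (x + sh e' *+ j))
     + (hess e e' r (x + sh e' *+ j) - hess e e' r x)); last by ring.
  apply: (le_trans (ler_normD _ _)); move: (lej _ x jk) (lei _ (x + sh e' *+ j) ik); lra.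
have incr : `|(E t (x + sh e' *+ k) - E t x) - (E s (x + sh e' *+ k) - E s x)| <=
    2 * H * rho `^ alpha * (t - s).
  apply: (@lipschitz_increment (fun r => E r (x + sh e' *+ k) - E r x)
    (fun r => (F r (x + sh e' *+ k + sh e *+ k) - F r (x + sh e' *+ k)) -
              (F r (x + sh e *+ k) - F r x))) => //; first exact: ltW.
  - exact: (within_continuous_sub (@continuous_steps e k (x + sh e' *+ k))
      (@continuous_steps e k x)).
  - move=> r rT; exact: (is_derive_sub (is_derive_steps e k (x + sh e' *+ k) rT)
      (is_derive_steps e k x rT)).
  - move=> r /andP[r0 rT]; apply: (le_trans (ler_normB _ _)).
    have rT' : 0 <= r <= T by rewrite !ltW.
    have := F_holder e k (x + sh e' *+ k) rT'; have := F_holder e k x rT'.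
    rewrite -/rho; lra.
have Hge : 0 <= H := H_ge0 x e tT'.
have rhop : rho `^ alpha * eta ^+ 2 <= rho ^+ 2 * eta `^ alpha.
  have -> : rho ^+ 2 = rho `^ alpha * rho `^ (2 - alpha).
    by rewrite -powRD ?(gt_eqF rho0) ?implybT // addrC subrK powR_mulrn // ltW.
  have -> : eta ^+ 2 = eta `^ alpha * eta `^ (2 - alpha).
    by rewrite -powRD ?(gt_eqF eta0) ?implybT // addrC subrK powR_mulrn // ltW.
  rewrite [leRHS]mulrAC -[leRHS]mulrA ler_wpM2l ?powR_ge0 // ler_wpM2l ?powR_ge0 //.
  by rewrite ge0_ler_powR ?nnegrE ?(ltW eta0) ?(ltW rho0) // subr_ge0 ltW // (lt_trans a1) // ltr1n.
rewrite -(ler_pM2l (exprn_gt0 2 rho0)) -{1}(ger0_norm (sqr_ge0 rho)) -normrM.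
have := close t tT'; have := close s sT; move: incr.
rewrite eta2.
set X := E t _ - _; set Y := E s _ - _; set p := hess e e' t x; set q := hess e e' s x.
move=> incr Hs Ht.
have -> : rho ^+ 2 * (p - q) =
   - (X - rho * (rho * p)) + (Y - rho * (rho * q)) + (X - Y) by ring.
apply: (le_trans (ler_normD _ _)); apply: (le_trans (lerD (ler_normD _ _) incr)).
rewrite normrN; have : 2 * H * (rho `^ alpha * eta ^+ 2) <= 2 * H * (rho ^+ 2 * eta `^ alpha).
  by rewrite ler_wpM2l // mulr_ge0.
lra.
Qed.

(** The Hessian needs [2 * H + 4 * S]; the gradient, estimated from it, costs one more [H]. *)
Definition time_cst : R := 3 * (B * (nD * M) + cp * (nD * S) + Ga) + 4 * S.

Let hess_time_dist e e' t s x : 0 <= t <= T -> 0 <= s <= T ->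
  `|hess e e' t x - hess e e' s x| <=
    (2 * H + 4 * S) * Num.sqrt `|t - s| `^ alpha.
Proof.
move=> tT sT; have Hge := H_ge0 x e tT.
have [st|ts|<-] := ltgtP s t; last first.
- by rewrite !subrr normr0 mulr_ge0 ?powR_ge0 // addr_ge0 // mulr_ge0.
- rewrite distrC [`|t - s|]distrC (ger0_norm (_ : 0 <= s - t)) ?subr_ge0 ?(ltW ts) //.
  by apply: hess_time_le => //; [case/andP: tT|case/andP: sT].
- rewrite (ger0_norm (_ : 0 <= t - s)) ?subr_ge0 ?(ltW st) //.
  by apply: hess_time_le => //; [case/andP: sT|case/andP: tT].
Qed.

Lemma hess_time e e' t s x : 0 <= t <= T -> 0 <= s <= T ->
  `|hess e e' t x - hess e e' s x| <= time_cst * Num.sqrt `|t - s| `^ alpha.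
Proof.
move=> tT sT; apply: (le_trans (hess_time_dist _ _ _ tT sT)).
rewrite ler_wpM2r ?powR_ge0 // /time_cst -/H; have := H_ge0 x e tT; lra.
Qed.

(** Same averaging along one walk, applied to [psi t - psi s]: its Hessian is already small by
    [hess_time_le], so its gradient is nearly constant over the walk. This is what gains the extra
    [sqrt (t - s)]. *)
Let dq_time_le e t s x : 0 <= s -> s < t -> t <= T ->
  `|dq e (psi t) x - dq e (psi s) x| <= time_cst * (t - s) `^ ((1 + alpha) / 2).
Proof.
move=> s0 st tT; have /andP[a01 a1] := alpha01.
have sT : 0 <= s <= T by rewrite s0 (le_trans (ltW st)).
have tT' : 0 <= t <= T by rewrite tT (le_trans s0 (ltW st)).
have eta0 : 0 < Num.sqrt (t - s) by rewrite sqrtr_gt0 subr_gt0.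
have eta2 : t - s = Num.sqrt (t - s) ^+ 2 by rewrite sqr_sqrtr // subr_ge0 ltW.
have -> : (t - s) `^ ((1 + alpha) / 2) = Num.sqrt (t - s) * Num.sqrt (t - s) `^ alpha.
  by rewrite powR_sqrt_mul // subr_gt0.
have Ht y : `|hess e e t y - hess e e s y| <= (2 * H + 4 * S) * Num.sqrt (t - s) `^ alpha.
  exact: hess_time_le.
set eta := Num.sqrt (t - s) in eta0 eta2 Ht *.
have [k k0 [etak jeta]] := steps_above_scale eta0.
set rho := k%:R / c in etak.
have rho0 : 0 < rho := lt_le_trans eta0 etak.
have Hge : 0 <= H := H_ge0 x e tT'.
pose u y := psi t y - psi s y.
have C0 : 0 <= (2 * H + 4 * S) * eta `^ alpha.
  by rewrite mulr_ge0 ?powR_ge0 // addr_ge0 // mulr_ge0.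
have dqu y : dq e u y = dq e (psi t) y - dq e (psi s) y by rewrite /u /dq; ring.
have close : `|u (x + sh e *+ k) - u x - rho * dq e u x| <=
    rho * (eta * ((2 * H + 4 * S) * eta `^ alpha)).
  apply: dq_average => j jk.
  apply: (@le_trans _ _ (j%:R / c * ((2 * H + 4 * S) * eta `^ alpha))).
    apply: dq_telescope => i ij; rewrite [X in `|X|](_ : _ =
      hess e e t (x + sh e *+ i) - hess e e s (x + sh e *+ i)) //.
    by rewrite /hess {1}/dq !dqu /dq; ring.
  by rewrite ler_wpM2r // jeta.
have incr : `|u (x + sh e *+ k) - u x| <= H * rho `^ alpha * (t - s).
  have -> : u (x + sh e *+ k) - u x =
    (psi t (x + sh e *+ k) - psi t x) - (psi s (x + sh e *+ k) - psi s x).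
    by rewrite /u; ring.
  apply: (@lipschitz_increment (fun r => psi r (x + sh e *+ k) - psi r x)
    (fun r => F r (x + sh e *+ k) - F r x)) => //; first exact: ltW.
  - by move=> r rT; exact: is_derive_steps.
  - by move=> r /andP[r0 rT]; apply: F_holder; rewrite !ltW.
have rhop : rho `^ alpha * eta ^+ 2 <= rho * (eta * eta `^ alpha).
  have -> : rho = rho `^ alpha * rho `^ (1 - alpha).
    by rewrite -powRD ?(gt_eqF rho0) ?implybT // addrC subrK powRr1 // ltW.
  rewrite (_ : (_ * _) `^ alpha = rho `^ alpha); last first.
    by congr (_ `^ _); rewrite -powRD ?(gt_eqF rho0) ?implybT // addrC subrK powRr1 // ltW.
  have {1}-> : eta ^+ 2 = eta * eta `^ alpha * eta `^ (1 - alpha).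
    by rewrite -mulrA -powRD ?(gt_eqF eta0) ?implybT // addrC subrK powRr1 ?ltW // expr2.
  rewrite -[leRHS]mulrA ler_wpM2l ?powR_ge0 // mulrC ler_wpM2r ?mulr_ge0 ?powR_ge0 ?(ltW eta0) //.
  by rewrite ge0_ler_powR ?nnegrE ?(ltW eta0) ?(ltW rho0) // subr_ge0 ltW.
rewrite -dqu -(ler_pM2l rho0) -{1}(ger0_norm (ltW rho0)) -normrM.
move: close incr; rewrite eta2; set X := u _ - u _; set p := dq e u x => close incr.
have -> : rho * p = - (X - rho * p) + X by ring.
apply: (le_trans (ler_normD _ _)); rewrite normrN; apply: (le_trans (lerD close incr)).
have : H * (rho `^ alpha * eta ^+ 2) <= H * (rho * (eta * eta `^ alpha)) by rewrite ler_wpM2l.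
rewrite /time_cst -/H; lra.
Qed.

Lemma dq_time e t s x : 0 <= t <= T -> 0 <= s <= T ->
  `|dq e (psi t) x - dq e (psi s) x| <= time_cst * `|t - s| `^ ((1 + alpha) / 2).
Proof.
move=> tT sT; have Hge := H_ge0 x e tT.
have [st|ts|<-] := ltgtP s t; last first.
- rewrite !subrr normr0 mulr_ge0 ?powR_ge0 // /time_cst -/H.
  by rewrite addr_ge0 // mulr_ge0.
- rewrite distrC [`|t - s|]distrC (ger0_norm (_ : 0 <= s - t)) ?subr_ge0 ?(ltW ts) //.
  by apply: dq_time_le => //; [case/andP: tT|case/andP: sT].
- rewrite (ger0_norm (_ : 0 <= t - s)) ?subr_ge0 ?(ltW st) //.
  by apply: dq_time_le => //; [case/andP: sT|case/andP: tT].
Qed.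

End TimeRegularity.

(** The first summand is the bound of [hess_holder], the second the term [2 * W / r] of
    [hess_interpolation], at the scale with [r^alpha = ((32 * freezing_cst + 1) * (B + 1))^-1]; the
    power [alpha^-1] is the part of [1 / r] independent of [B]. *)
Definition space_cst : R :=
  4 * (1 + 2 * freezing_cst + 32 * freezing_cst * (32 * freezing_cst + 1) `^ alpha^-1)
  + 2 * (32 * freezing_cst + 1) `^ alpha^-1.

Definition schauder_cst : R :=
  3 * nD * space_cst * (1 + cp) + 3 + 4 * space_cst.

Lemma lattice_schauder (v0 : V) (e0 : D) : 0 <= T ->
  let X := (B + 1) `^ (1 + 1 / alpha) * W + Ga + I in
  let Y := (B + 1) `^ (1 / alpha) * W + (B + 1)^-1 * (Ga + I) in
  [/\ forall e e' t x, 0 <= t <= T -> `|hess e e' t x| <= schauder_cst * Y,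
      hess_holder_bound (schauder_cst * X),
      forall e e' t s x, 0 <= t <= T -> 0 <= s <= T ->
        `|hess e e' t x - hess e e' s x| <= schauder_cst * X * Num.sqrt `|t - s| `^ alpha &
      forall e t s x, 0 <= t <= T -> 0 <= s <= T ->
        `|dq e (psi t) x - dq e (psi s) x| <=
          schauder_cst * X * `|t - s| `^ ((1 + alpha) / 2)].
Proof.
move=> T0 X Y; have /andP[a01 a1] := alpha01.
have zT : 0 <= (0 : R) <= T by rewrite lexx.
have W0 : 0 <= W by apply: le_trans (W_bound e0 v0 zT).
have cp0 : 0 <= cp.
  by have /andP[h1 h2] := a_bound v0 zT; exact: le_trans (ltW cm_gt0) (le_trans h1 h2).
have A0 := freezing_cst_ge0; set A := freezing_cst in A0.
have th0 : 0 < 32 * A + 1 by rewrite ltr_wpDl // mulr_ge0.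
have B1 : 0 < B + 1 by rewrite ltr_wpDl.
set L := (32 * A + 1) `^ alpha^-1.
have L0 : 0 <= L by exact: powR_ge0.
set P := (B + 1) `^ (1 / alpha) * W.
have P0 : 0 <= P by rewrite mulr_ge0 // powR_ge0.
have GI0 : 0 <= (B + 1)^-1 * (Ga + I) by rewrite mulr_ge0 ?invr_ge0 ?addr_ge0 // ltW.
have Y0 : 0 <= Y by rewrite addr_ge0.
(* The Hessian bound is the seminorm bound times [r^alpha], up to constants; this identity makes
   both announced forms come from one estimate. *)
have XY : X = (B + 1) * Y.
  rewrite /X /Y powRD ?(gt_eqF B1) ?implybT // powRr1 ?(ltW B1) //.
  by rewrite mulrDr mulVKf ?gt_eqF // !mulrA addrA.
have X0 : 0 <= X by rewrite XY mulr_ge0 // ltW.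
have XP : X = (B + 1) * P + Ga + I.
  by rewrite /X /P powRD ?(gt_eqF B1) ?implybT // powRr1 ?(ltW B1) // !mulrA.
pose r := ((32 * A + 1) * (B + 1)) `^ (- alpha^-1).
have r0 : 0 < r by rewrite powR_gt0 // mulr_gt0.
have ra : r `^ alpha = (32 * A + 1)^-1 * (B + 1)^-1.
  rewrite /r -powRrM mulNr mulVf ?gt_eqF // powR_inv1 ?mulr_ge0 ?(ltW B1) ?(ltW th0) //.
  by rewrite invfM.
have Wr : W / r = L * P.
  rewrite /r powRN invrK powRM ?(ltW B1) ?(ltW th0) // /P div1r.
  by rewrite mulrC mulrA.
have Ar : 32 * A * B * r `^ alpha <= 1.
  rewrite ra -invfM ler_pdivrMr ?mulr_gt0 // mul1r.
  have -> : (32 * A + 1) * (B + 1) = 32 * A * B + (32 * A + B + 1) by ring.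
  by rewrite lerDl; move: A0 B_ge0; lra.
have H1 := hess_holder r0 Ar.
pose S := space_cst * X; pose M := space_cst * Y.
have sp0 : 0 <= space_cst.
  rewrite /space_cst -/A -/L; have := mulr_ge0 A0 L0; lra.
have S0 : 0 <= S by exact: mulr_ge0.
have AL := mulr_ge0 A0 L0.
set S1 := 4 * _ in H1.
have S1E : S1 = 4 * (I + 2 * (A * Ga) + 32 * (A * L * (B * P))).
  by rewrite /S1 -/A; rewrite -[32 * A * B * W / r]mulrA Wr; ring.
have leS1 : S1 <= 4 * (1 + 2 * A + 32 * A * L) * X.
  rewrite S1E.
  have BPX : B * P <= X by rewrite XP; move: P0 Ga_ge0 I_ge0; lra.
  have h1 : A * Ga <= A * X.
    by rewrite ler_wpM2l // XP; move: I_ge0 (mulr_ge0 (ltW B1) P0); lra.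
  have h2 : A * L * (B * P) <= A * L * X by rewrite ler_wpM2l.
  have h3 : I <= X by rewrite XP; move: Ga_ge0 (mulr_ge0 (ltW B1) P0); lra.
  lra.
have S10 : 0 <= S1.
  rewrite S1E.
  move: I_ge0 (mulr_ge0 A0 Ga_ge0) (mulr_ge0 AL (mulr_ge0 B_ge0 P0)); lra.
have HS : hess_holder_bound S.
  move=> e e' l k x t tT; apply: (le_trans (H1 e e' l k x t tT)).
  rewrite ler_wpM2r ?powR_ge0 //; apply: (le_trans leS1).
  by rewrite /S ler_wpM2r // /space_cst -/A -/L lerDl mulr_ge0.
have HM e e' t x : 0 <= t <= T -> `|hess e e' t x| <= M.
  move=> tT; apply: (le_trans (hess_interpolation _ _ _ tT r0 S10 H1)).
  have -> : 2 * W / r = 2 * (L * P) by rewrite -mulrA Wr.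
  have -> : M = 4 * (1 + 2 * A + 32 * A * L) * Y + 2 * (L * Y).
    by rewrite /M /space_cst -/A -/L; ring.
  rewrite ra; apply: lerD.
    apply: (@le_trans _ _ (4 * (1 + 2 * A + 32 * A * L) * X * (B + 1)^-1)).
      apply: ler_pM => //; first by rewrite mulr_ge0 // invr_ge0 ltW.
      rewrite ler_piMl ?invr_ge0 ?(ltW B1) // invf_le1 // lerDr mulr_ge0 //.
    by rewrite XY [(B + 1) * Y]mulrC -!mulrA divff ?gt_eqF // mulr1.
  by rewrite !ler_wpM2l // /Y lerDl.
have BM : B * M <= space_cst * X.
  rewrite /M mulrCA ler_wpM2l // XY ler_wpM2r // lerDl //.
have time_le : time_cst M S <= schauder_cst * X.
  rewrite /time_cst /schauder_cst.
  have h1 : nD * (B * M) <= nD * (space_cst * X) by rewrite ler_wpM2l.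
  have h2 : Ga <= X by rewrite XP; move: I_ge0 (mulr_ge0 (ltW B1) P0); lra.
  rewrite [leLHS](_ : _ = 3 * (nD * (B * M)) + 3 * (cp * (nD * S)) + 3 * Ga + 4 * S); last by ring.
  rewrite /S; move: h1 h2; set Z := nD * (B * M); lra.
have sc : space_cst <= schauder_cst.
  rewrite /schauder_cst; have : 0 <= 3 * nD * space_cst * (1 + cp).
    by rewrite !mulr_ge0 // addr_ge0.
  lra.
split.
- by move=> e e' t x tT; apply: (le_trans (HM _ _ _ _ tT)); rewrite ler_wpM2r.
- move=> e e' l k x t tT; apply: (le_trans (HS e e' l k x t tT)).
  by rewrite ler_wpM2r ?powR_ge0 // ler_wpM2r.
- move=> e e' t s x tT sT; apply: (le_trans (hess_time HM S0 HS _ _ _ tT sT)).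
  by rewrite ler_wpM2r ?powR_ge0.
- move=> e t s x tT sT; apply: (le_trans (dq_time HM S0 HS _ _ tT sT)).
  by rewrite ler_wpM2r ?powR_ge0.
Qed.

End FreezingCoefficients.

(** * The discrete torus *)

Section CyclicDistance.
Variable p : nat.
Implicit Types (x y : 'I_p.+1) (k : int).

Definition cdist y : nat := minn y (p.+1 - y).

Lemma inZp1_mulrn (k : nat) : (inZp 1 : 'I_p.+1) *+ k = inZp k.
Proof. by rewrite Zp_mulrn; apply: val_inj; rewrite /= modnMml mul1n. Qed.

Lemma cdistN y : cdist (- y) = cdist y.
Proof.
rewrite /cdist /=; have [y0|y0] := posnP y.
  by rewrite y0 subn0 modnn !min0n.
rewrite modn_small; last by rewrite ltn_subrL y0.
by rewrite subKn 1?minnC // ltnW.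
Qed.

Lemma cdist_le k : (cdist ((inZp 1 : 'I_p.+1) *~ k) <= `|k|)%N.
Proof.
have H (j : nat) : (cdist (inZp j : 'I_p.+1) <= j)%N.
  apply: leq_trans (geq_minl _ _) _; exact: leq_mod.
case: k => j; first by rewrite -pmulrn inZp1_mulrn.
by rewrite NegzE mulrNz -pmulrn cdistN inZp1_mulrn abszN.
Qed.

(** The sign is kept as a boolean to match the encoding of unit vectors in [dir], for the
    decomposition [sum_steps]. *)
Lemma cdist_repr y :
  exists b : bool, y = (inZp 1 : 'I_p.+1) *~ ((-1) ^+ b * (cdist y)%:Z).
Proof.
have [yy|yy] := leqP y (p.+1 - y).
  exists false; rewrite expr0 mul1r /cdist (minn_idPl yy) -pmulrn inZp1_mulrn.
  by apply: val_inj; rewrite /= modn_small.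
exists true; rewrite expr1 mulN1r /cdist (minn_idPr (ltnW yy)) mulrNz -pmulrn.
rewrite inZp1_mulrn; apply: val_inj => /=.
have yp := ltn_ord y; have y0 : (0 < y)%N by case: (y : nat) yy => //; rewrite subn0.
rewrite (@modn_small (p.+1 - y)) ?ltn_subrL ?y0 //.
by rewrite subKn ?modn_small // ltnW.
Qed.

Lemma cdist_reprz y :
  exists2 k, y = (inZp 1 : 'I_p.+1) *~ k & `|k|%N = cdist y.
Proof.
have [b Hb] := cdist_repr y; exists ((-1) ^+ b * (cdist y)%:Z) => //.
by rewrite abszMsign.
Qed.

(** The integer [q] undoes the wrap-around of addition modulo [p.+1]; it supplies the competitor in
    the infimum defining [torus_dist]. *)
Lemma cdist_shift x y :
  exists q : int,
    absz ((x : nat)%:Z - ((x + y)%R : nat)%:Z + p.+1%:Z * q) = cdist y.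
Proof.
have E := divn_eq (x + y) p.+1; set Q := ((x + y) %/ p.+1)%N in E.
have -> : ((x + y)%R : nat) = ((x + y) %% p.+1)%N by [].
have yp := ltn_ord y.
have [yy|yy] := leqP y (p.+1 - y).
  exists (- Q%:Z); rewrite /cdist (minn_idPl yy); lia.
by exists (1 - Q%:Z); rewrite /cdist (minn_idPr (ltnW yy)); lia.
Qed.

End CyclicDistance.

Section TorusLattice.
Variables (R : realType) (n N : nat).
Hypothesis N_gt0 : (0 < N)%N.
Local Notation V := (dtorus n N).
Local Notation D := (dir n).
Local Notation sh := (fun e : D => latt N (dvec e)).
Local Notation c := (N%:R : R).
Implicit Types (x y z : V) (e : D).

Lemma lattD (k l : 'rV[int]_n) : latt N (k + l) = latt N k + latt N l.
Proof. by apply/rowP => j; rewrite !mxE mulrzDr. Qed.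

Lemma lattN (k : 'rV[int]_n) : latt N (- k) = - latt N k.
Proof. by apply/rowP => j; rewrite !mxE mulrNz. Qed.

Lemma dvec_dopp e : dvec (Defs.dopp e) = - dvec e.
Proof.
by case: e => b i; rewrite /dvec /=; case: b; rewrite /= ?expr0 ?expr1 ?scaleN1r ?scale1r ?opprK.
Qed.

Lemma dopp_invol : involutive (@Defs.dopp n).
Proof. by case=> b i; rewrite /Defs.dopp /= negbK. Qed.

Lemma sh_dopp e : sh (Defs.dopp e) = - sh e.
Proof. by rewrite /= dvec_dopp lattN. Qed.

Lemma sh_coord b i j : sh (b, i) 0 j =
  (inZp 1 : 'I_N.-1.+1) *~ (if j == i then (-1) ^+ b else 0).
Proof.
by rewrite /= !mxE eqxx /=; case: (j == i); rewrite ?mulr1 ?mulr0.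
Qed.

Definition tnorm y : R :=
  Num.sqrt (\sum_j ((cdist (y 0 j))%:R / c) ^+ 2).

Let NE : N.-1.+1 = N. Proof. exact: prednK. Qed.
Let c_gt0 : 0 < c. Proof. by rewrite ltr0n. Qed.

Lemma tnorm_ge0 y : 0 <= tnorm y.
Proof. exact: sqrtr_ge0. Qed.

Lemma tnorm_sqr y : tnorm y ^+ 2 = \sum_j ((cdist (y 0 j))%:R / c) ^+ 2.
Proof. by rewrite sqr_sqrtr // sumr_ge0 // => j _; exact: sqr_ge0. Qed.

Lemma tnorm0 : tnorm 0 = 0.
Proof.
rewrite /tnorm big1 ?sqrtr0 // => j _; rewrite mxE /cdist /= min0n.
by rewrite mul0r expr0n.
Qed.

Lemma cdist_le_tnorm y j : (cdist (y 0 j))%:R / c <= tnorm y.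
Proof.
rewrite -[leLHS]ger0_norm ?divr_ge0 // -sqrtr_sqr; apply: ler_wsqrtr.
by rewrite (bigD1 j) //= lerDl sumr_ge0 // => i _; exact: sqr_ge0.
Qed.

(* For a representative [k] of minimal absolute value of [y],
   [cdist (y +- 1) <= |k +- 1|] and [(k + 1)^2 + (k - 1)^2 - 2 k^2 = 2]. *)
Lemma cdist_second_difference (y : 'I_N.-1.+1) :
  (cdist (y + (inZp 1 : 'I_N.-1.+1) *~ 1))%:R ^+ 2
  + (cdist (y + (inZp 1 : 'I_N.-1.+1) *~ (-1)))%:R ^+ 2
  - 2 * (cdist y)%:R ^+ 2 <= 2 :> R.
Proof.
have [k -> <-] := cdist_reprz y.
have H (s : int) : (cdist ((inZp 1 : 'I_N.-1.+1) *~ k + inZp 1 *~ s))%:R ^+ 2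
    <= ((k + s)%:~R : R) ^+ 2.
  rewrite -mulrzDr -[leRHS]real_normK ?num_real // lerXn2r ?nnegrE //.
  by rewrite -intr_norm -abszE ler_nat cdist_le.
have -> : (`|k|%N)%:R ^+ 2 = (k%:~R : R) ^+ 2.
  by rewrite -[RHS]real_normK ?num_real // -intr_norm -abszE.
have := H 1; have := H (-1); rewrite !intrD /=; lra.
Qed.

Lemma lap_tnorm y : lap sh c (fun z => tnorm z ^+ 2) y <= (2 * n)%:R.
Proof.
pose f (y : 'I_N.-1.+1) : R := ((cdist y)%:R / c) ^+ 2.
have split (b : bool) i : c * dq sh c (b, i) (fun z => tnorm z ^+ 2) y =
    c ^+ 2 * (f (y 0 i + (inZp 1 : 'I_N.-1.+1) *~ (-1) ^+ b) - f (y 0 i)).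
  rewrite /dq mulrA -expr2; congr (_ * _).
  rewrite !tnorm_sqr -sumrB (bigD1 i) //= [X in _ + X]big1 ?addr0.
    by rewrite mxE -/(sh (b, i)) sh_coord eqxx.
  move=> j ji; rewrite mxE -/(sh (b, i)) sh_coord (negbTE ji) mulr0z addr0 subrr //.
rewrite /lap -(pair_bigA _ (fun b i => c * dq sh c (b, i) (fun z => tnorm z ^+ 2) y)) /=.
rewrite big_bool /= -big_split /=.
apply: (@le_trans _ _ (\sum_(i < n) 2)); last first.
  by rewrite sumr_const card_ord -mulrnA.
apply: ler_sum => i _; rewrite !split /f !exprMn exprVn.
apply: le_trans (cdist_second_difference (y 0 i)).
rewrite expr1 expr0 le_eqVlt; apply/orP; left; apply/eqP.
by field; rewrite gt_eqF.
Qed.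

Lemma cdist_step (y : 'I_N.-1.+1) (b : bool) :
  (cdist (y + (inZp 1 : 'I_N.-1.+1) *~ (-1) ^+ b)%R <= (cdist y).+1)%N.
Proof.
have [k -> <-] := cdist_reprz y.
rewrite -mulrzDr; apply: leq_trans (cdist_le _ _) _.
by case: b; rewrite ?expr1 ?expr0; lia.
Qed.

(** Proved on squares: a single coordinate moves, and it is bounded by the whole norm in the cross
    term. *)
Lemma tnorm_step y e : tnorm (y + sh e) <= tnorm y + c^-1.
Proof.
case: e => b i; have ci0 : 0 <= c^-1 by rewrite invr_ge0 ltW.
have ty := tnorm_ge0 y.
rewrite -[leRHS]ger0_norm ?addr_ge0 // -sqrtr_sqr {1}/tnorm.
apply: ler_wsqrtr; rewrite sqrrD tnorm_sqr.
rewrite (bigD1 i) //= [X in _ <= X + _ + _](bigD1 i) //=.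
rewrite [X in _ + X <= _](eq_bigr (fun j => ((cdist (y 0 j))%:R / c) ^+ 2)); last first.
  by move=> j ji; rewrite mxE -/(sh (b, i)) sh_coord (negbTE ji) mulr0z addr0.
rewrite mxE -/(sh (b, i)) sh_coord eqxx.
have h1 : (cdist (y 0 i + (inZp 1 : 'I_N.-1.+1) *~ (-1) ^+ b))%:R / c <=
    (cdist (y 0 i))%:R / c + c^-1.
  have -> : (cdist (y 0 i))%:R / c + c^-1 = (cdist (y 0 i)).+1%:R / c.
    by rewrite -natr1 mulrDl mul1r.
  by rewrite ler_wpM2r // ler_nat cdist_step.
have h2 := cdist_le_tnorm y i.
set u := _ / c in h1 *; set v := _ / c in h1 h2 *; set W := \sum_(_ | _) _.
have u0 : 0 <= u by rewrite divr_ge0.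
have v0 : 0 <= v by rewrite divr_ge0.
have : u ^+ 2 <= (v + c^-1) ^+ 2 by rewrite lerXn2r ?nnegrE ?addr_ge0.
rewrite sqrrD mulr2n; have : v * c^-1 <= tnorm y * c^-1 by rewrite ler_wpM2r.
set ci := c^-1; rewrite mulr2n; lra.
Qed.

Lemma sum_steps y (b : 'I_n -> bool) :
  (forall j, y 0 j = (inZp 1 : 'I_N.-1.+1) *~ ((-1) ^+ b j * (cdist (y 0 j))%:Z)) ->
  y = \sum_j sh (b j, j) *+ cdist (y 0 j).
Proof.
move=> H; apply/rowP => i; rewrite summxE (bigD1 i) //= big1 ?addr0.
  rewrite mulmxnE -/(sh (b i, i)) sh_coord eqxx pmulrn -mulrzA.
  exact: H.
move=> j ji; rewrite mulmxnE -/(sh (b j, j)) sh_coord eq_sym (negbTE ji) mulr0z mul0rn //.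
Qed.

Lemma tnorm_holder (alpha : R) (u : V -> R) (S : R) : 0 <= alpha -> 0 <= S ->
  (forall e k x, `|u (x + sh e *+ k) - u x| <= S * (k%:R / c) `^ alpha) ->
  forall x y, `|u (x + y) - u x| <= n%:R * S * tnorm y `^ alpha.
Proof.
move=> a0 S0 H x y.
have [b Hb] := choice (fun j => cdist_repr (y 0 j)).
rewrite {1}(sum_steps Hb) -mulrA mulr_natl -[X in _ *+ X]card_ord -sumr_const.
elim: (index_enum _) x => [|j s IH] x.
  by rewrite !big_nil addr0 subrr normr0.
rewrite !big_cons addrA.
set z := sh (b j, j) *+ _.
rewrite (_ : u _ - u x = (u (x + z) - u x) +
  (u (x + z + \sum_(i <- s) sh (b i, i) *+ cdist (y 0 i)) - u (x + z))); last by ring.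
apply: (le_trans (ler_normD _ _)); apply: lerD; last exact: IH.
apply: (le_trans (H _ _ _)); rewrite ler_wpM2l //.
by rewrite ge0_ler_powR ?nnegrE ?tnorm_ge0 ?divr_ge0 ?cdist_le_tnorm.
Qed.

Lemma enorm_ge0 (v : 'rV[R]_n) : 0 <= enorm v.
Proof. exact: sqrtr_ge0. Qed.

Lemma torus_dist_le (v w : 'rV[R]_n) (k : 'rV[int]_n) :
  torus_dist v w <= enorm (v - w + map_mx intr k).
Proof.
apply: ge_inf; last by exists k.
by exists 0 => _ [l _ <-]; exact: enorm_ge0.
Qed.

Lemma torus_dist_ge0 (v w : 'rV[R]_n) : 0 <= torus_dist v w.
Proof.
apply: lb_le_inf; first by exists (enorm (v - w + map_mx intr 0)); exists 0.
by move=> _ [l _ <-]; exact: enorm_ge0.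
Qed.

(** Transfers the hypotheses stated with [torus_dist] to [tnorm], whose square splits into
    coordinates. *)
Lemma torus_dist_pt x y : torus_dist (torus_pt R x) (torus_pt R (x + y)) <= tnorm y.
Proof.
have [q Hq] := choice (fun j => cdist_shift (x 0 j) (y 0 j)).
apply: (le_trans (torus_dist_le _ _ (\row_j q j))).
apply: ler_wsqrtr; apply: ler_sum => j _.
rewrite !mxE -(Hq j) le_eqVlt; apply/orP; left; apply/eqP.
rewrite natr_absz intr_norm [RHS]exprMn real_normK ?num_real // -exprMn.
congr (_ ^+ 2).
have NR : (N.-1.+1%:Z)%:~R = c :> R by rewrite -pmulrn NE.
rewrite !intrD intrM NR mulrNz -!pmulrn.
by field; rewrite gt_eqF.
Qed.

Lemma sh_mulN e : sh e *+ N = 0.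
Proof.
case: e => b i; apply/rowP => j; rewrite mulmxnE -/(sh (b, i)) sh_coord mxE.
rewrite -mulrz_nat mulrzAC mulrz_nat inZp1_mulrn.
have -> : inZp N = 0 :> 'I_N.-1.+1 by apply: val_inj; rewrite /= -[X in (X %% _)%N]NE modnn.
by rewrite mul0rz.
Qed.

(* The constant is kept because, modulo [N], only
   displacements [k / N <= 1] matter. *)
Lemma lipschitz_holder (alpha : R) (u : V -> R) (L : R) : 0 < alpha <= 1 -> 0 <= L ->
  (forall e x, `|dq sh c e u x| <= L) ->
  forall e k x, `|u (x + sh e *+ k) - u x| <= L * (k%:R / c) `^ alpha.
Proof.
move=> /andP[a0 a1] L0 H e k x.
have -> : sh e *+ k = sh e *+ (k %% N).
  by rewrite {1}(divn_eq k N) mulrnDr mulnC mulrnA sh_mulN mul0rn add0r.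
have kN : (k %% N)%:R / c <= 1 :> R.
  by rewrite ler_pdivrMr // mul1r ler_nat ltnW // ltn_mod.
have kk : 0 <= (k %% N)%:R / c :> R by rewrite divr_ge0.
apply: (@le_trans _ _ ((k %% N)%:R / c * L)).
  by apply: (@dq_telescope R V D sh c c_gt0 u e (k %% N) x L) => j _; exact: H.
rewrite mulrC ler_wpM2l //.
apply: (@le_trans _ _ (((k %% N)%:R / c) `^ alpha)).
  have [->|k0] := eqVneq ((k %% N)%:R / c) 0; first exact: powR_ge0.
  by rewrite ger1_powR // lt0r k0 kk.
rewrite ge0_ler_powR ?nnegrE ?(ltW a0) ?divr_ge0 //.
by rewrite ler_wpM2r ?invr_ge0 // ler_nat leq_mod.
Qed.

End TorusLattice.

(** * Polylinear interpolation *)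

Section PiecewiseLinear.
Variables (R : realType) (c alpha S : R) (A : int -> R).
Hypothesis c_gt0 : 0 < c.
Hypothesis alpha01 : 0 < alpha <= 1.
Hypothesis S_ge0 : 0 <= S.
Hypothesis A_holder : forall k m : int,
  `|A k - A m| <= S * (`|k - m|%:~R / c) `^ alpha.

Let fl (b : R) : int := Num.floor (c * b).
Let fr (b : R) : R := c * b - (fl b)%:~R.
Definition plin (b : R) : R := (1 - fr b) * A (fl b) + fr b * A (fl b + 1).

Let fr_ge0 b : 0 <= fr b.
Proof. by rewrite subr_ge0 floor_le_tmp. Qed.

Let fr_le1 b : fr b <= 1.
Proof.
by rewrite lerBlDr addrC ltW // -[1]/(1%:~R) -intrD -floor_lt_int ?ltzD1.
Qed.

(** For a fraction [s <= 1] of one cell, [s <= s^alpha] turns the linear interpolation into a Hölder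
    bound at length [s / c]. *)
Let short (k : int) (s t : R) : 0 <= s <= 1 -> s / c <= t ->
  s * `|A (k + 1) - A k| <= S * t `^ alpha.
Proof.
move=> /andP[s0 s1] st; have /andP[a0 a1] := alpha01.
have H := A_holder (k + 1) k; rewrite addrAC subrr add0r normr1 in H.
apply: (@le_trans _ _ (S * (s `^ alpha * (1%:~R / c) `^ alpha))).
  rewrite mulrCA; apply: ler_pM => //.
  have [->|sn0] := eqVneq s 0; first exact: powR_ge0.
  by rewrite ger1_powR // lt0r sn0 s0.
rewrite ler_wpM2l // -powRM ?divr_ge0 ?(ltW c_gt0) //.
rewrite ge0_ler_powR ?nnegrE ?(ltW a0) ?mulr_ge0 ?invr_ge0 ?(ltW c_gt0) ?mul1r //.
by apply: le_trans st; rewrite divr_ge0 // ltW.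
Qed.

Let plin_le b b' : b <= b' -> `|plin b' - plin b| <= 3 * S * (b' - b) `^ alpha.
Proof.
move=> bb; have /andP[a0 a1] := alpha01.
have cb : c * b <= c * b' by rewrite ler_wpM2l // ltW.
have p0 : 0 <= S * (b' - b) `^ alpha by rewrite mulr_ge0 ?powR_ge0.
have : fl b <= fl b' by exact: le_floor.
rewrite le_eqVlt => /orP[/eqP E|lt_fl].
  have fE : fr b' - fr b = c * (b' - b) by rewrite /fr E; ring.
  have -> : plin b' - plin b = (fr b' - fr b) * (A (fl b + 1) - A (fl b)).
    by rewrite /plin E; ring.
  have f0 : 0 <= fr b' - fr b by rewrite fE mulr_ge0 ?subr_ge0 // ltW.
  rewrite normrM (ger0_norm f0).
  have := @short (fl b) (fr b' - fr b) (b' - b).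
  rewrite f0 /= {2}fE [c * _]mulrC mulfK ?gt_eqF // lexx => /(_ _ isT) H.
  have {}H : (fr b' - fr b) * `|A (fl b + 1) - A (fl b)| <= S * (b' - b) `^ alpha.
    by apply: H; move: (fr_le1 b') (fr_ge0 b); lra.
  by apply: (le_trans H); rewrite -mulrA ler_peMl // ler1n.
(* A partial cell at each end and whole cells in between, each at most [S * (b' - b)^alpha]: hence
   the factor [3]. *)
have -> : plin b' - plin b =
   fr b' * (A (fl b' + 1) - A (fl b')) + (A (fl b') - A (fl b + 1))
   + (1 - fr b) * (A (fl b + 1) - A (fl b)) by rewrite /plin; ring.
have lt1 : fl b + 1 <= fl b' by rewrite lezD1.
have lt1R : (fl b)%:~R + 1 <= (fl b')%:~R :> R.
  by rewrite -[1]/(1%:~R) -intrD ler_int.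
have h1 : fr b' * `|A (fl b' + 1) - A (fl b')| <= S * (b' - b) `^ alpha.
  apply: short; first by rewrite fr_ge0 fr_le1.
  rewrite ler_pdivrMr // mulrC mulrBr; move: (fr_le1 b); rewrite /fr; lra.
have h2 : (1 - fr b) * `|A (fl b + 1) - A (fl b)| <= S * (b' - b) `^ alpha.
  apply: short; first by rewrite subr_ge0 fr_le1 lerBlDr lerDl fr_ge0.
  rewrite ler_pdivrMr // mulrC mulrBr; move: (fr_ge0 b'); rewrite /fr; lra.
have h3 : `|A (fl b') - A (fl b + 1)| <= S * (b' - b) `^ alpha.
  apply: (le_trans (A_holder _ _)); rewrite ler_wpM2l //.
  have d0 : 0 <= fl b' - (fl b + 1) by rewrite subr_ge0.
  rewrite (ger0_norm d0); rewrite ge0_ler_powR ?nnegrE ?subr_ge0 ?(ltW a0) //.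
    by rewrite divr_ge0 ?(ltW c_gt0) // ler0z.
  rewrite ler_pdivrMr // mulrC mulrBr intrB intrD.
  move: (fr_ge0 b') (fr_le1 b); rewrite /fr; lra.
apply: (le_trans (ler_normD _ _)); apply: (@le_trans _ _ (S * (b' - b) `^ alpha
  + S * (b' - b) `^ alpha + S * (b' - b) `^ alpha)); last by lra.
apply: lerD; last by rewrite normrM ger0_norm // subr_ge0.
apply: (le_trans (ler_normD _ _)); apply: lerD => //.
by rewrite normrM ger0_norm.
Qed.

Lemma plin_holder b b' : `|plin b - plin b'| <= 3 * S * `|b - b'| `^ alpha.
Proof.
have [bb|/ltW bb] := leP b b'; last first.
  by rewrite (ger0_norm (_ : 0 <= b - b')) ?subr_ge0 //; exact: plin_le.
by rewrite distrC [`|b - b'|]distrC (ger0_norm (_ : 0 <= b' - b)) ?subr_ge0 //; exact: plin_le.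
Qed.

End PiecewiseLinear.

Section Interpolation.
Variables (R : realType) (n N : nat).
Hypothesis N_gt0 : (0 < N)%N.
Local Notation V := (dtorus n N).
Local Notation D := (dir n).
Local Notation sh := (fun e : D => latt N (dvec e)).
Local Notation c := (N%:R : R).
Implicit Types (f g : V -> R) (z y w : 'rV[R]_n).

Definition cell z (v : {ffun 'I_n -> bool}) : 'rV[int]_n :=
  \row_i (Num.floor (c * z 0 i) + (v i)%:Z).

Definition polylin f z : R :=
  \sum_(v : {ffun 'I_n -> bool})
    (\prod_(i < n) theta N (v i) (z 0 i)) * f (latt N (cell z v)).

Let c_gt0 : 0 < c. Proof. by rewrite ltr0n. Qed.

Lemma theta_ge0 (b : bool) (r : R) : 0 <= theta N b r.
Proof.
rewrite /theta; case: b; first by rewrite subr_ge0 floor_le_tmp.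
rewrite subr_ge0 lerBlDr addrC ltW // -[1]/(1%:~R) -intrD -floor_lt_int ?ltzD1 //.
Qed.

Lemma sum_theta z :
  \sum_(v : {ffun 'I_n -> bool}) \prod_(i < n) theta N (v i) (z 0 i) = 1 :> R.
Proof.
rewrite -(bigA_distr_bigA (fun i b => theta N b (z 0 i))) /=.
by rewrite big1 // => i _; rewrite big_bool /theta /=; ring.
Qed.

Lemma polylinB f g z : polylin (fun x => f x - g x) z = polylin f z - polylin g z.
Proof. by rewrite -sumrB; apply: eq_bigr => v _; rewrite mulrBr. Qed.

Lemma polylinZ a f z : polylin (fun x => a * f x) z = a * polylin f z.
Proof. by rewrite mulr_sumr; apply: eq_bigr => v _; rewrite mulrCA. Qed.

Lemma polylin_bound f M z : (forall x, `|f x| <= M) -> `|polylin f z| <= M.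
Proof.
move=> H; rewrite -[M]mul1r -(sum_theta z) mulr_suml.
apply: (le_trans (ler_norm_sum _ _ _)); apply: ler_sum => v _.
have p0 : 0 <= \prod_(i < n) theta N (v i) (z 0 i) :> R.
  by apply: prodr_ge0 => i _; exact: theta_ge0.
by rewrite normrM (ger0_norm p0) ler_wpM2l.
Qed.

Lemma theta_shift (b : bool) (r : R) (k : int) :
  theta N b (r + c^-1 * k%:~R) = theta N b r.
Proof.
have E : c * (r + c^-1 * k%:~R) = c * r + k%:~R by rewrite mulrDr mulVKf ?gt_eqF.
rewrite /theta E floorDrz ?intr_int // intrKfloor intrD.
by case: b; ring.
Qed.

Lemma polylin_shift f z (k : 'rV[int]_n) :
  polylin f (z + c^-1 *: map_mx intr k) = polylin (fun x => f (x + latt N k)) z.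
Proof.
apply: eq_bigr => v _; congr (_ * f _).
  by apply: eq_bigr => i _; rewrite !mxE theta_shift.
rewrite -lattD; congr (latt N _); apply/rowP => i; rewrite !mxE.
by rewrite mulrDr mulVKf ?gt_eqF // floorDrz ?intr_int // intrKfloor addrAC.
Qed.

(** The weights are invariant under lattice translations, so differences and interpolation
    commute. *)
Lemma nabla_interp (e : D) (u : R -> V -> R) (t : R) z :
  nabla N e (interp u) (t, z) = polylin (dnabla e (u t)) z.
Proof.
rewrite /nabla /= -[interp u _]/(polylin (u t) (z + c^-1 *: map_mx intr (dvec e))).
by rewrite polylin_shift /dnabla polylinZ polylinB.
Qed.

Lemma latt_mulN (k : 'rV[int]_n) : latt N (N%:Z *: k) = 0.
Proof.
apply/rowP => j; rewrite !mxE mulrzA -pmulrn inZp1_mulrn.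
have -> : inZp N = 0 :> 'I_N.-1.+1.
  by apply: val_inj; rewrite /= -[X in (X %% _)%N](prednK N_gt0) modnn.
by rewrite mul0rz.
Qed.

Lemma polylin_periodic f z (k : 'rV[int]_n) :
  polylin f (z + map_mx intr k) = polylin f z.
Proof.
have -> : map_mx intr k = c^-1 *: map_mx intr (N%:Z *: k) :> 'rV[R]_n.
  by apply/rowP => j; rewrite !mxE intrM -pmulrn mulKf // gt_eqF.
rewrite polylin_shift; apply: eq_bigr => v _.
by rewrite latt_mulN addr0.
Qed.

Section OneCoordinate.
Variables (f : V -> R) (alpha S : R) (l : 'I_n) (z : 'rV[R]_n).
Hypothesis alpha01 : 0 < alpha <= 1.
Hypothesis S_ge0 : 0 <= S.
Hypothesis f_holder : forall e k x,
  `|f (x + sh e *+ k) - f x| <= S * (k%:R / c) `^ alpha.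

Let flip (v : {ffun 'I_n -> bool}) : {ffun 'I_n -> bool} :=
  [ffun i => if i == l then ~~ v i else v i].

Let flipK : involutive flip.
Proof. by move=> v; apply/ffunP => i; rewrite !ffunE; case: (i == l); rewrite ?negbK. Qed.

Let weight (v : {ffun 'I_n -> bool}) : R := \prod_(i < n | i != l) theta N (v i) (z 0 i).

Let cell_at (k : int) (v : {ffun 'I_n -> bool}) : 'rV[int]_n :=
  \row_i (if i == l then k else Num.floor (c * z 0 i) + (v i)%:Z).

(** Interpolation in all coordinates but [l], on the hyperplane of index [k]; in the remaining
    coordinate the polylinear interpolation is [plin] of these values. *)
Definition slice g (k : int) : R :=
  \sum_(v : {ffun 'I_n -> bool} | ~~ v l) weight v * g (latt N (cell_at k v)).

Let polylin_slice g (h : R) :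
  polylin g (z + h *: delta_mx 0 l) = plin c (slice g) (z 0 l + h).
Proof.
set z' := z + _.
have zl : z' 0 l = z 0 l + h by rewrite !mxE !eqxx mulr1.
have zi i : i != l -> z' 0 i = z 0 i by move=> il; rewrite !mxE (negbTE il) andbF mulr0 addr0.
clearbody z'.
rewrite /polylin (bigID (fun v : {ffun 'I_n -> bool} => v l)) /=.
(* Each vertex on the upper face in direction [l] is paired with the one below it. *)
rewrite [X in X + _](reindex_inj (inv_inj flipK)) /=.
rewrite (eq_bigl (fun v : {ffun 'I_n -> bool} => ~~ v l)); last first.
  by move=> v; rewrite !ffunE eqxx.
rewrite /plin /slice !mulr_sumr [LHS]addrC -!big_split /=; apply: eq_bigr => v vl.
have W (v' : {ffun 'I_n -> bool}) : (forall i, i != l -> v' i = v i) ->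
    \prod_(i < n) theta N (v' i) (z' 0 i) = theta N (v' l) (z 0 l + h) * weight v.
  move=> vv; rewrite (bigD1 l) //= zl; congr (_ * _).
  by apply: eq_bigr => i il; rewrite vv // zi.
rewrite !W //; last by move=> i il; rewrite ffunE (negbTE il).
rewrite ffunE eqxx (negbTE vl) /=.
have -> : cell z' v = cell_at (Num.floor (c * (z 0 l + h))) v.
  apply/rowP => i; rewrite !mxE; case: eqP => [->|/eqP il].
    by rewrite zl (negbTE vl) addr0.
  by rewrite zi.
have -> : cell z' (flip v) = cell_at (Num.floor (c * (z 0 l + h)) + 1) v.
  apply/rowP => i; rewrite !mxE ffunE; case: eqP => [->|/eqP il].
    by rewrite zl (negbTE vl).
  by rewrite zi.
by rewrite /theta !mulrA.
Qed.

Let weight_sum : \sum_(v : {ffun 'I_n -> bool} | ~~ v l) weight v = 1.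
Proof.
have := polylin_slice (fun=> 1) 0.
have sl k : slice (fun=> 1) k = \sum_(v : {ffun 'I_n -> bool} | ~~ v l) weight v.
  by apply: eq_bigr => v _; rewrite mulr1.
rewrite scale0r addr0 /plin !sl -mulrDl subrK mul1r => <-.
by rewrite -[RHS](sum_theta z); apply: eq_bigr => v _; rewrite mulr1.
Qed.

Let weight_ge0 v : 0 <= weight v.
Proof. by apply: prodr_ge0 => i _; exact: theta_ge0. Qed.

Let slice_holder (k m : int) :
  `|slice f k - slice f m| <= S * (`|k - m|%:~R / c) `^ alpha.
Proof.
rewrite -sumrB -[leRHS]mul1r -[X in _ <= X * _]weight_sum mulr_suml.
apply: (le_trans (ler_norm_sum _ _ _)); apply: ler_sum => v _.
rewrite -mulrBr normrM (ger0_norm (weight_ge0 v)) ler_wpM2l //.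
have cellD : cell_at k v = cell_at m v + (k - m) *: delta_mx 0 l.
  apply/rowP => i; rewrite !mxE eqxx /=; case: eqP => _.
    by rewrite mulr1 addrC subrK.
  by rewrite mulr0 addr0.
have E : latt N ((k - m) *: delta_mx 0 l) = sh (k - m < 0, l) *+ absz (k - m).
  apply/rowP => j.
  rewrite [RHS]mulmxnE -/(sh (k - m < 0, l)) sh_coord [RHS]pmulrn -[RHS]mulrzA.
  rewrite !mxE eqxx /=.
  congr (_ *~ _); case: (j == l); last by rewrite mulr0 mul0r.
  by rewrite mulr1 {1}[k - m]intEsign.
rewrite cellD lattD E; apply: (le_trans (f_holder _ _ _)).
by rewrite natr_absz.
Qed.

Lemma polylin_coordinate (h : R) :
  `|polylin f (z + h *: delta_mx 0 l) - polylin f z| <= 3 * S * `|h| `^ alpha.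
Proof.
have := polylin_slice f 0; rewrite scale0r addr0 => E0.
rewrite polylin_slice E0 addr0.
apply: (le_trans (plin_holder c_gt0 alpha01 S_ge0 slice_holder _ _)).
by rewrite addrAC subrr add0r.
Qed.

End OneCoordinate.

Lemma coord_le_enorm y j : `|y 0 j| <= enorm y.
Proof.
rewrite -sqrtr_sqr; apply: ler_wsqrtr.
by rewrite (bigD1 j) //= lerDl sumr_ge0 // => i _; exact: sqr_ge0.
Qed.

Lemma polylin_holder f (alpha S : R) z y : 0 < alpha <= 1 -> 0 <= S ->
  (forall e k x, `|f (x + sh e *+ k) - f x| <= S * (k%:R / c) `^ alpha) ->
  `|polylin f z - polylin f y| <= 3 * n%:R * S * torus_dist z y `^ alpha.
Proof.
move=> a01 S0 H; have /andP[a0 a1] := a01.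
have step w : `|polylin f (y + w) - polylin f y| <= 3 * n%:R * S * enorm w `^ alpha.
  rewrite {1}(row_sum_delta w) [leRHS](_ : _ = (3 * S * enorm w `^ alpha) *+ n); last first.
    by rewrite -mulr_natr; ring.
  rewrite -[X in _ *+ X]card_ord -sumr_const.
  elim: (index_enum _) y => [|j s IH] y'.
    by rewrite !big_nil addr0 subrr normr0.
  rewrite !big_cons addrA.
  rewrite (_ : polylin f _ - polylin f y' =
    (polylin f (y' + w 0 j *: delta_mx 0 j) - polylin f y')
    + (polylin f (y' + w 0 j *: delta_mx 0 j + \sum_(j <- s) w 0 j *: delta_mx 0 j)
      - polylin f (y' + w 0 j *: delta_mx 0 j))); last by ring.
  apply: (le_trans (ler_normD _ _)); apply: lerD; last exact: IH.
  apply: (le_trans (polylin_coordinate j y' a01 S0 H (w 0 j))).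
  rewrite ler_wpM2l ?mulr_ge0 // ge0_ler_powR ?nnegrE ?(ltW a0) ?enorm_ge0 //.
  exact: coord_le_enorm.
have {}step (k : 'rV[int]_n) : `|polylin f z - polylin f y| <=
    3 * n%:R * S * enorm (z - y + map_mx intr k) `^ alpha.
  by rewrite -(polylin_periodic f z k) (_ : z + _ = y + (z - y + map_mx intr k));
    [exact: step|rewrite addrA [y + _]addrC subrK].
(* The bound holds for every integer translate. To pass to the infimum in [torus_dist], the
   inequality is solved for [enorm], which requires dividing by [K] and inverting the power. *)
set K := 3 * n%:R * S in step *.
have K0 : 0 <= K by rewrite !mulr_ge0.
have [KE|Kn] := eqVneq K 0.
  by have := step 0; rewrite KE !mul0r.
have Kp : 0 < K by rewrite lt0r Kn.
rewrite mulrC -ler_pdivrMr //; set X := `|_| / K.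
have X0 : 0 <= X by rewrite divr_ge0.
have -> : X = (X `^ alpha^-1) `^ alpha by rewrite -powRrM mulVf ?gt_eqF // powRr1.
rewrite ge0_ler_powR ?nnegrE ?(ltW a0) ?powR_ge0 ?torus_dist_ge0 //.
apply: lb_le_inf; first by exists (enorm (z - y + map_mx intr 0)); exists 0.
move=> _ [k _ <-].
have -> : enorm (z - y + map_mx intr k) = (enorm (z - y + map_mx intr k) `^ alpha) `^ alpha^-1.
  by rewrite -powRrM mulfV ?gt_eqF // powRr1 // enorm_ge0.
rewrite ge0_ler_powR ?nnegrE ?powR_ge0 // ?invr_ge0 ?(ltW a0) //.
by rewrite /X ler_pdivrMr // mulrC.
Qed.

End Interpolation.

(** * Estimates for the system *)

Section TorusEstimate.
Variables (R : realType) (n N : nat).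
Hypothesis N_gt0 : (0 < N)%N.
Local Notation V := (dtorus n N).
Local Notation D := (dir n).
Local Notation sh := (fun e : D => latt N (dvec e)).
Local Notation c := (N%:R : R).
Local Notation dq := (dq sh c).
Local Notation lap := (lap sh c).

Let c_gt0 : 0 < c. Proof. by rewrite ltr0n. Qed.

(** With this sign the system takes the parabolic form with right-hand side
    [dq e (abar * lap psi + g)]. *)
Lemma sum_dnabla_adj (u : V -> R) x :
  \sum_(j < n) dnabla_adj (dpos j) (dnabla (dpos j) u) x = - lap u x.
Proof.
rewrite /lap -(pair_bigA _ (fun b i => c * dq (b, i) u x)) /= big_bool /=.
rewrite -big_split /= -sumrN; apply: eq_bigr => j _.
rewrite /dnabla_adj /dnabla -[dvec (Defs.dopp _)]/(dvec (true, j)).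
have -> : dvec (dpos j) = - dvec (true, j) by rewrite -dvec_dopp.
rewrite /dq -[(false, j)]/(Defs.dopp (true, j)) dvec_dopp lattN addrK; ring.
Qed.

Lemma CN_norm_ge (k : nat) (u : V -> R) (es : seq D) x : (size es <= k)%N ->
  `|foldr dq u es x| <= CN_norm k u.
Proof.
move=> sk; have sk' : (size es < k.+1)%N by [].
rewrite /CN_norm (bigD1 (Ordinal sk')) //= (bigD1 (in_tuple es)) //=.
have M0 (es' : seq D) : 0 <= \big[Num.max/0]_x `|foldr (@dnabla R n N) u es' x|.
  by elim/big_ind: _ => // a b a0 b0; rewrite le_max a0.
rewrite -addrA; apply: ler_wpDr.
  by rewrite addr_ge0 // sumr_ge0 // => i _; rewrite ?sumr_ge0.
exact: (le_bigmax _ (fun x => `|foldr (@dnabla R n N) u es x|)).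
Qed.

Variables (T : R) (psi abar g : R -> V -> R).
Hypothesis solves : solves_system T abar g psi.

(** The system speaks of positive directions only; a negative difference is minus the positive one
    at the neighbouring point. *)
Lemma solves_system_continuous e x :
  {within `[0, T], continuous (fun t => dq e (psi t) x)}.
Proof.
case: e => -[] i; last by case: (solves i x).
have [cx _] := solves i (x + sh (true, i)).
have -> : (fun t => dq (true, i) (psi t) x) = (fun t => -1 * xi psi i t (x + sh (true, i))).
  apply/funext => t; rewrite /xi /dnabla /dq.
  have -> : dvec (dpos i) = - dvec (true, i) by rewrite -dvec_dopp.
  by rewrite lattN addrK; ring.
exact: within_continuous_scale.
Qed.

Lemma solves_system_derive e x t : 0 < t < T ->
  is_derive t 1 (fun s => dq e (psi s) x)
    (dq e (fun y => abar t y * lap (psi t) y + g t y) x).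
Proof.
move=> tT.
have pos i y : is_derive t 1 (fun s => xi psi i s y)
    (dnabla (dpos i) (fun y => abar t y * lap (psi t) y + g t y) y).
  have [_ /(_ t tT) Dx] := solves i y.
  apply: (is_derive_eq Dx).
  rewrite /dnabla; under eq_bigr do rewrite -[xi _ _ _]/(dnabla (dpos _) (psi t)).
  by rewrite !sum_dnabla_adj; ring.
case: e => -[] i; last exact: pos.
have E (u : V -> R) : dq (true, i) u x = -1 * dnabla (dpos i) u (x + sh (true, i)).
  rewrite /dnabla /dq.
  have -> : dvec (dpos i) = - dvec (true, i) by rewrite -dvec_dopp.
  by rewrite lattN addrK; ring.
rewrite E.
have -> : (fun s => dq (true, i) (psi s) x) = (fun s => -1 * xi psi i s (x + sh (true, i))).
  by apply/funext => s; rewrite E.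
exact: is_derive_scale.
Qed.

Lemma dq_bound (M : R) (u : V -> R) :
  (forall i x, `|dnabla (dpos i) u x| <= M) -> forall e x, `|dq e u x| <= M.
Proof.
move=> H [[] i] x; last exact: H.
rewrite (_ : dq (true, i) u x = - dnabla (dpos i) u (x + sh (true, i))) ?normrN //.
rewrite /dnabla /dq.
have -> : dvec (dpos i) = - dvec (true, i) by rewrite -dvec_dopp.
by rewrite lattN addrK; ring.
Qed.

Variables (alpha cm cp B C0 G W : R).
Hypothesis n_gt0 : (0 < n)%N.
Hypothesis alpha01 : 0 < alpha < 1.
Hypothesis cm_gt0 : 0 < cm.
Hypothesis T_ge0 : 0 <= T.
Hypothesis B_ge0 : 0 <= B.
Hypothesis abar_bound : forall t x, 0 <= t <= T -> cm <= abar t x <= cp.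
Hypothesis abar_holder : forall t1 t2 x1 x2, 0 <= t1 <= T -> 0 <= t2 <= T ->
  `|abar t1 x1 - abar t2 x2| <=
    B * (`|t2 - t1| `^ (alpha / 2)
         + torus_dist (torus_pt R x2) (torus_pt R x1) `^ alpha).
Hypothesis g_lipschitz : forall e t x, 0 <= t <= T -> `|dq e (g t) x| <= G.
Hypothesis xi_bound : forall i t x, 0 <= t <= T -> `|xi psi i t x| <= W.
Hypothesis psi0_bound : CN_norm 4 (psi 0) <= C0.

(** The factor [n] absorbs the Hölder constant [n * G] that [tnorm_holder] gives for [g]. *)
Definition torus_cst : R :=
  n%:R * schauder_cst D (2 * n)%:R alpha cm cp n%:R.

Lemma torus_schauder :
  let X := (B + 1) `^ (1 + 1 / alpha) * W + G + C0 in
  let Y := (B + 1) `^ (1 / alpha) * W + (B + 1)^-1 * (G + C0) in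
  [/\ 0 <= torus_cst,
      forall e e' t x, 0 <= t <= T -> `|dq e' (dq e (psi t)) x| <= torus_cst * Y,
      forall e e' l k x t, 0 <= t <= T ->
        `|dq e' (dq e (psi t)) (x + sh l *+ k) - dq e' (dq e (psi t)) x|
          <= torus_cst * X * (k%:R / c) `^ alpha,
      forall e e' t s x, 0 <= t <= T -> 0 <= s <= T ->
        `|dq e' (dq e (psi t)) x - dq e' (dq e (psi s)) x|
          <= torus_cst * X * Num.sqrt `|t - s| `^ alpha &
      forall e t s x, 0 <= t <= T -> 0 <= s <= T ->
        `|dq e (psi t) x - dq e (psi s) x| <=
          torus_cst * X * `|t - s| `^ ((1 + alpha) / 2)].
Proof.
move=> X Y; have /andP[a0 a1] := alpha01.
have al1 : 0 < alpha <= 1 by rewrite a0 ltW.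
pose e0 : D := (false, Ordinal n_gt0).
have zT : 0 <= (0 : R) <= T by rewrite lexx.
have G0 : 0 <= G by apply: le_trans (g_lipschitz e0 0 zT).
have W0 : 0 <= W by apply: le_trans (xi_bound (Ordinal n_gt0) 0 zT).
have C00 : 0 <= C0.
  by apply: le_trans psi0_bound; apply: le_trans (CN_norm_ge (psi 0) (es := [::]) 0 isT).
have n1 : 1 <= n%:R :> R by rewrite ler1n.
have nG0 : 0 <= n%:R * G by rewrite mulr_ge0.
have a_holder t s x y : 0 <= t <= T -> 0 <= s <= T ->
    `|abar s (x + y) - abar t x| <= B * (`|t - s| `^ (alpha / 2) + tnorm R y `^ alpha).
  move=> tT sT; apply: (le_trans (abar_holder _ _ sT tT)).
  rewrite ler_wpM2l // lerD2l ge0_ler_powR ?nnegrE ?(ltW a0) //.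
  - exact: torus_dist_ge0.
  - exact: tnorm_ge0.
  - exact: torus_dist_pt.
have g_holder t x y : 0 <= t <= T ->
    `|g t (x + y) - g t x| <= n%:R * G * tnorm R y `^ alpha.
  move=> tT; apply: (@tnorm_holder R n N alpha (g t) G (ltW a0) G0) => e k z.
  by apply: lipschitz_holder => // e' z'; exact: g_lipschitz.
have hess0 (e e' l : D) (k : nat) (x : V) :
    `|hess sh c psi e e' 0 (x + sh l *+ k) - hess sh c psi e e' 0 x|
      <= C0 * (k%:R / c) `^ alpha.
  apply: lipschitz_holder => // e1 x1; apply: le_trans psi0_bound.
  exact: (CN_norm_ge (psi 0) (es := [:: e1; e'; e])).
have := lattice_schauder (@dopp_invol n) (@sh_dopp n N) c_gt0 (@tnorm0 R n N)
  (@tnorm_ge0 R n N) (ler0n R (2 * n)) (lap_tnorm R N_gt0) (tnorm_step R N_gt0)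
  (ler0n R n) alpha01 (fun u S => @tnorm_holder R n N alpha u S (ltW a0))
  cm_gt0 B_ge0 nG0 solves_system_continuous solves_system_derive abar_bound
  a_holder g_holder C00
  (fun e t x tT => dq_bound (fun i y => xi_bound i y tT) e x) hess0 (0 : V) e0 T_ge0.
cbv zeta; set Cs := schauder_cst _ _ _ _ _ _.
set X' := _ * W + n%:R * G + C0; set Y' := _ + _ * (n%:R * G + C0).
move=> [H1 H2 H3 H4].
have cp0 : 0 <= cp.
  by have /andP[h1 h2] := abar_bound 0 zT; exact: le_trans (ltW cm_gt0) (le_trans h1 h2).
have Cs0 : 0 <= Cs.
  have f0 := freezing_cst_ge0 D (2 * n)%:R cm cp (ler0n R n) alpha01.
  have L0 : 0 <= (32 * freezing_cst D (2 * n)%:R alpha cm cp n%:R + 1) `^ alpha^-1.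
    exact: powR_ge0.
  have s0 : 0 <= space_cst D (2 * n)%:R alpha cm cp n%:R.
    by rewrite /space_cst; have := mulr_ge0 f0 L0; lra.
  rewrite /Cs /schauder_cst; have : 0 <= 3 * #|D|%:R * space_cst D (2 * n)%:R alpha cm cp n%:R * (1 + cp).
    by rewrite !mulr_ge0 // addr_ge0.
  lra.
have B1 : 0 < B + 1 by rewrite ltr_wpDl.
have leX : Cs * X' <= torus_cst * X.
  rewrite /torus_cst -/Cs [n%:R * Cs]mulrC -mulrA ler_wpM2l // /X' /X !mulrDr.
  apply: lerD; last by rewrite ler_peMl.
  by rewrite lerD // ler_peMl // mulr_ge0 // powR_ge0.
have leY : Cs * Y' <= torus_cst * Y.
  rewrite /torus_cst -/Cs [n%:R * Cs]mulrC -mulrA ler_wpM2l // /Y' /Y !mulrDr.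
  apply: lerD; first by rewrite ler_peMl // mulr_ge0 // powR_ge0.
  apply: lerD; first by rewrite mulrCA.
  by rewrite ler_peMl // mulr_ge0 // invr_ge0 ltW.
split.
- exact: mulr_ge0 (ler0n _ _) Cs0.
- by move=> e e' t x tT; apply: (le_trans (H1 e e' t x tT)).
- move=> e e' l k x t tT; apply: (le_trans (H2 e e' l k x t tT)).
  by rewrite ler_wpM2r // powR_ge0.
- move=> e e' t s x tT sT; apply: (le_trans (H3 e e' t s x tT sT)).
  by rewrite ler_wpM2r // powR_ge0.
- move=> e t s x tT sT; apply: (le_trans (H4 e t s x tT sT)).
  by rewrite ler_wpM2r // powR_ge0.
Qed.

End TorusEstimate.

Lemma powR_ge1 (R : realType) (b r : R) : 1 <= b -> 0 <= r -> 1 <= b `^ r.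
Proof. by move=> b1 r0; rewrite -(powRr0 b) ler_powR. Qed.

(** * Suprema in the extended reals and the final estimate *)

Section ExtendedSuprema.
Variable R : realType.

Lemma bigmaxe_le (n : nat) (F : 'I_n -> \bar R) (K : R) : 0 <= K ->
  (forall i, (F i <= K%:E)%E) -> (\big[maxe/0]_(i < n) F i <= K%:E)%E.
Proof.
move=> K0 H; elim/big_ind: _ => [|a b aK bK|i _]; last exact: H.
  by rewrite lee_fin.
by rewrite ge_max aK.
Qed.

Lemma bigmax_le_const (n : nat) (F : 'I_n -> R) (K : R) : 0 <= K ->
  (forall i, F i <= K) -> \big[Num.max/0]_(i < n) F i <= K.
Proof.
move=> K0 H; elim/big_ind: _ => [//|a b aK bK|i _]; last exact: H.
by rewrite ge_max aK.
Qed.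

Lemma sup_norm_le (A : Type) (D : set A) (F : A -> R) (K : R) :
  (forall a, D a -> `|F a| <= K) -> (sup_norm D F <= K%:E)%E.
Proof. by move=> H; apply: ge_ereal_sup => _ [a Da <-]; rewrite lee_fin H. Qed.

Lemma le_sup_norm (A : Type) (D : set A) (F : A -> R) (K : R) a :
  (sup_norm D F <= K%:E)%E -> D a -> `|F a| <= K.
Proof.
move=> H Da; rewrite -lee_fin; apply: le_trans H.
by apply: ereal_sup_ubound; exists a.
Qed.

(* Covers the junk case [p = 0], where the quotient is [0]. *)
Lemma ratio_le (x p K : R) : 0 <= K -> 0 <= p -> x <= K * p -> x / p <= K.
Proof.
move=> K0; rewrite le_eqVlt => /orP[/eqP<- _|p0].
  by rewrite invr0 mulr0.
by rewrite ler_pdivrMr.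
Qed.

End ExtendedSuprema.

Section InterpolatedBounds.
Variables (R : realType) (n N : nat) (T alpha X M W : R).
Variable u : R -> dtorus n N -> R.
Hypothesis N_gt0 : (0 < N)%N.
Hypothesis alpha01 : 0 < alpha < 1.
Hypothesis X_ge0 : 0 <= X.
Hypothesis u_bound : forall t x, 0 <= t <= T -> `|u t x| <= W.
Hypothesis nabla_bound : forall i t x, 0 <= t <= T -> `|dnabla (dpos i) (u t) x| <= M.
Hypothesis nabla_space : forall i l k x t, 0 <= t <= T ->
  `|dnabla (dpos i) (u t) (x + latt N (dvec l) *+ k) - dnabla (dpos i) (u t) x|
    <= X * (k%:R / N%:R) `^ alpha.
Hypothesis nabla_time : forall i t s x, 0 <= t <= T -> 0 <= s <= T ->
  `|dnabla (dpos i) (u t) x - dnabla (dpos i) (u s) x|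
    <= X * Num.sqrt `|t - s| `^ alpha.
Hypothesis u_time : forall t s x, 0 <= t <= T -> 0 <= s <= T ->
  `|u t x - u s x| <= X * `|t - s| `^ ((1 + alpha) / 2).

Lemma nabla_interp_bound i :
  (sup_norm (@cyl R T 'rV[R]_n) (nabla N (dpos i) (interp u)) <= M%:E)%E.
Proof.
apply: sup_norm_le => -[t z] tT; rewrite nabla_interp //.
by apply: polylin_bound => x; exact: nabla_bound.
Qed.

Lemma nabla_interp_increment i (P Q : R * 'rV[R]_n) : cyl T P -> cyl T Q ->
  `|nabla N (dpos i) (interp u) P - nabla N (dpos i) (interp u) Q|
    <= (3 * n%:R + 1) * X * par_dist P Q `^ alpha.
Proof.
case: P Q => [t z] [s y] tT sT; have /andP[a0 a1] := alpha01.
have al1 : 0 < alpha <= 1 by rewrite a0 ltW.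
rewrite !nabla_interp // (_ : _ - _ =
  (polylin (dnabla (dpos i) (u t)) z - polylin (dnabla (dpos i) (u t)) y)
  + polylin (fun x => dnabla (dpos i) (u t) x - dnabla (dpos i) (u s) x) y); last first.
  by rewrite polylinB; ring.
apply: (le_trans (ler_normD _ _)).
rewrite [leRHS](_ : _ = 3 * n%:R * X * par_dist (t, z) (s, y) `^ alpha
  + X * par_dist (t, z) (s, y) `^ alpha); last by ring.
have p0 : 0 <= par_dist (t, z) (s, y) by rewrite le_max sqrtr_ge0.
apply: lerD.
  apply: (le_trans (polylin_holder N_gt0 z y al1 X_ge0
    (fun l k x => nabla_space i l k x tT))).
  rewrite ler_wpM2l ?mulr_ge0 // ge0_ler_powR ?nnegrE ?(ltW a0) ?torus_dist_ge0 //.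
  by rewrite le_max lexx orbT.
apply: polylin_bound => x; apply: (le_trans (nabla_time i x tT sT)).
rewrite ler_wpM2l // ge0_ler_powR ?nnegrE ?(ltW a0) ?sqrtr_ge0 //.
by rewrite le_max lexx.
Qed.

Let K_ge0 : 0 <= (3 * n%:R + 1) * X.
Proof. by rewrite mulr_ge0 // addr_ge0 // mulr_ge0. Qed.

Lemma nabla_interp_holder i :
  (holder T alpha (nabla N (dpos i) (interp u)) <= ((3 * n%:R + 1) * X)%:E)%E.
Proof.
apply: ge_ereal_sup => _ [P [Q [PT QT _ ->]]].
by rewrite lee_fin ratio_le ?powR_ge0 // nabla_interp_increment.
Qed.

Lemma interp_holder1_norm :
  (holder1_norm N T alpha (interp u) <= ((3 * n%:R + 2) * X + W)%:E)%E.
Proof.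
have -> : (3 * n%:R + 2) * X + W = (3 * n%:R + 1) * X + X + W by ring.
rewrite 2!EFinD; apply: leeD; first apply: leeD.
- apply: ge_ereal_sup => _ [P [Q [PT QT _ ->]]].
  rewrite lee_fin ratio_le ?powR_ge0 //; apply: bigmax_le_const => [|i].
    by rewrite mulr_ge0 // powR_ge0.
  exact: nabla_interp_increment.
- apply: ge_ereal_sup => _ [t [s [z [tT sT _ ->]]]].
  rewrite lee_fin ratio_le ?powR_ge0 //.
  rewrite -[interp u (t, z)]/(polylin (u t) z) -[interp u (s, z)]/(polylin (u s) z).
  by rewrite -polylinB; apply: polylin_bound => x; exact: u_time.
- apply: sup_norm_le => -[t z] tT.
  by apply: (@polylin_bound R n N (u t)) => x; exact: u_bound.
Qed.

End InterpolatedBounds.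

Theorem theorem5p7 (R : realType) :
  exists (C' : R) (C6 C7 : R -> R -> R -> R -> R),
    (forall Bbar C0 C1 alpha : R,
       0 <= Bbar -> 0 <= C0 -> 0 <= C1 -> 0 < alpha < 1 ->
       C6 Bbar C0 C1 alpha
         <= C' * (Bbar + 1) `^ (1 / alpha) * C0 * (1 + C1 ^+ 5) /\
       C7 Bbar C0 C1 alpha
         <= C' * (Bbar + 1) `^ (2 / alpha) * C0 * (1 + C1 ^+ 11)) /\
    forall (n : nat) (cm cp T alpha : R),
      (0 < n)%N -> 0 < cm -> cm < cp -> 0 < T -> 0 < alpha < 1 ->
      exists C : R,
        forall (Bbar C0 C1 G W : R)
               (abar g psi : forall N : nat, R -> dtorus n N -> R),
          (forall (N : nat) (x : dtorus n N), (0 < N)%N ->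
             {within `[0, T], continuous (fun t : R => g N t x)}) ->
          (forall N : nat, (0 < N)%N ->
             solves_system T (abar N) (g N) (psi N)) ->
          (forall (N : nat) (t : R) (x : dtorus n N), (0 < N)%N ->
             0 <= t <= T -> cm <= abar N t x <= cp) ->
          (forall (N : nat) (t1 t2 : R) (x1 x2 : dtorus n N), (0 < N)%N ->
             0 <= t1 <= T -> 0 <= t2 <= T ->
             `|abar N t1 x1 - abar N t2 x2|
               <= Bbar * (`|t2 - t1| `^ (alpha / 2)
                          + torus_dist (torus_pt R x2) (torus_pt R x1)
                              `^ alpha)) ->
          (forall N : nat, (0 < N)%N -> CN_norm 4 (abar N 0) <= C1) ->
          (forall (N : nat) (e : dir n), (0 < N)%N ->
             (sup_norm (@cyl R T (dtorus n N))
                (fun X => dnabla e (g N X.1) X.2) <= G%:E)%E) ->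
          (forall (N : nat) (i : 'I_n), (0 < N)%N ->
             (sup_norm (@cyl R T (dtorus n N))
                (fun X => xi (psi N) i X.1 X.2) <= W%:E)%E) ->
          (forall N : nat, (0 < N)%N -> CN_norm 4 (psi N 0) <= C0) ->
          forall N : nat, (0 < N)%N ->
            let c6 := C6 Bbar C0 C1 alpha in
            let c7 := C7 Bbar C0 C1 alpha in
            [/\ (\big[maxe/0]_(i < n)
                   holder1_norm N T alpha (interp (xi (psi N) i))
                 <= (C * ((Bbar + 1) `^ (1 + 1 / alpha) * (W + c6)
                          + G + c7))%:E)%E,
                (\big[maxe/0]_(i < n) \big[maxe/0]_(j < n)
                   sup_norm (@cyl R T 'rV[R]_n)
                     (nabla N (dpos j) (interp (xi (psi N) i)))
                 <= (C * ((Bbar + 1) `^ (1 / alpha) * (W + c6)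
                          + (Bbar + 1)^-1 * (G + c7)))%:E)%E &
                (\big[maxe/0]_(i < n) \big[maxe/0]_(j < n)
                   holder T alpha (nabla N (dpos j) (interp (xi (psi N) i)))
                 <= (C * ((Bbar + 1) `^ (1 + 1 / alpha) * (W + c6)
                          + G + c7))%:E)%E].
Proof.
exists 1, (fun _ _ _ _ => 0), (fun _ C0 _ _ => C0); split.
  move=> B C0 C1 alpha B0 C00 C10 /andP[a0 a1].
  have P1 : 1 <= (B + 1) `^ (2 / alpha).
    by rewrite powR_ge1 ?lerDr // divr_ge0 // ltW.
  have Q1 : 1 <= 1 + C1 ^+ 11 by rewrite lerDl exprn_ge0.
  split.
    by rewrite !mulr_ge0 ?powR_ge0 // addr_ge0 // exprn_ge0.
  by rewrite mul1r mulrAC ler_peMl // mulr_ege1.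
move=> n cm cp T alpha n0 cm0 cmp T0 alpha01.
have /andP[a0 a1] := alpha01.
(* Spatial interpolation costs [3 * n], the time increments of the gradient and of [xi] cost [1]
   each, and the last [1] pays for the supremum norm through [W <= X]. *)
exists ((3 * n%:R + 2) * torus_cst n alpha cm cp + 1).
move=> B C0 C1 G W abar g psi _ Hsol Hab Hah _ Hg Hxi Hpsi0 N N0 /=.
rewrite addr0.
have zT : 0 <= (0 : R) <= T by rewrite lexx ltW.
have TT : 0 <= T <= T by rewrite lexx andbT ltW.
have B0 : 0 <= B.
  (* The sign of [Bbar] is read off at the times [0] and [T], where the bracket is positive. *)
  have := le_trans (normr_ge0 _) (Hah N 0 T 0 0 N0 zT TT).
  rewrite pmulr_lge0 //; apply: ltr_pwDl; last exact: powR_ge0.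
  by rewrite powR_gt0 // normr_gt0 subr0 gt_eqF.
have HG e t x : 0 <= t <= T -> `|dnabla e (g N t) x| <= G.
  by move=> tT; apply: (le_sup_norm (a := (t, x)) (Hg N e N0)).
have HW i t x : 0 <= t <= T -> `|xi (psi N) i t x| <= W.
  by move=> tT; apply: (le_sup_norm (a := (t, x)) (Hxi N i N0)).
have W0 : 0 <= W by apply: le_trans (HW (Ordinal n0) 0 0 zT).
have G0 : 0 <= G by apply: le_trans (HG (false, Ordinal n0) 0 0 zT).
have C00 : 0 <= C0.
  by apply: le_trans (Hpsi0 N N0); apply: le_trans (CN_norm_ge (psi N 0) (es := [::]) 0 isT).
have := torus_schauder N0 (Hsol N N0) n0 alpha01 cm0 (ltW T0) B0
  (fun t x => Hab N t x N0) (fun t1 t2 x1 x2 => Hah N t1 t2 x1 x2 N0) HG HW (Hpsi0 N N0).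
cbv zeta; set K := torus_cst _ _ _ _; set X := _ * W + G + C0; set Y := _ + _ * (G + C0).
move=> [K0 H1 H2 H3 H4].
have B1 : 1 <= B + 1 by rewrite lerDr.
have P0 (r : R) : 0 <= (B + 1) `^ r by exact: powR_ge0.
have X0 : 0 <= X by rewrite !addr_ge0 // mulr_ge0.
have Y0 : 0 <= Y.
  by rewrite addr_ge0 ?mulr_ge0 ?invr_ge0 ?addr_ge0.
have WX : W <= X.
  have : W <= (B + 1) `^ (1 + 1 / alpha) * W.
    by rewrite ler_peMl // powR_ge1 // addr_ge0 // divr_ge0 // ltW.
  rewrite /X; lra.
have KX0 : 0 <= K * X by rewrite mulr_ge0.
have KY0 : 0 <= K * Y by rewrite mulr_ge0.
have n1 : 0 <= n%:R :> R by exact: ler0n.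
have nKX : 0 <= n%:R * (K * X) by rewrite mulr_ge0.
have nKY : 0 <= n%:R * (K * Y) by rewrite mulr_ge0.
have C_ge (Z : R) : 0 <= Z -> 0 <= ((3 * n%:R + 2) * K + 1) * Z.
  by move=> Z0; rewrite mulr_ge0 // addr_ge0 // mulr_ge0 // addr_ge0 // mulr_ge0.
split.
- apply: bigmaxe_le => [|i]; first exact: C_ge.
  have := interp_holder1_norm N0 alpha01 KX0 (HW i)
    (fun j l k x t tT => H2 (dpos i) (dpos j) l k x t tT)
    (fun j t s x tT sT => H3 (dpos i) (dpos j) t s x tT sT)
    (fun t s x tT sT => H4 (dpos i) t s x tT sT).
  move=> /le_trans; apply; rewrite lee_fin.
  rewrite [leRHS](_ : _ = (3 * n%:R + 2) * (K * X) + X); last by ring.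
  by rewrite lerD2l.
- apply: bigmaxe_le => [|i]; first exact: C_ge.
  apply: bigmaxe_le => [|j]; first exact: C_ge.
  have := nabla_interp_bound N0 (fun j t x tT => H1 (dpos i) (dpos j) t x tT) j.
  move=> /le_trans; apply; rewrite lee_fin; lra.
- apply: bigmaxe_le => [|i]; first exact: C_ge.
  apply: bigmaxe_le => [|j]; first exact: C_ge.
  have := nabla_interp_holder N0 alpha01 KX0
    (fun j l k x t tT => H2 (dpos i) (dpos j) l k x t tT)
    (fun j t s x tT sT => H3 (dpos i) (dpos j) t s x tT sT) j.
  move=> /le_trans; apply; rewrite lee_fin; lra.
Qed.
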